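(* Let $(V,B)$ be a right bialgebroid and let $R$ be a braided commutative monoid in ${}^V\mathbf{YD}_V$ (right-left Yetter-Drinfeld modules over $V$). Then $V\#R$ (with its structure maps as given in the context) is a right bialgebroid over $R$, and it is, in addition, a left Hopf algebroid if $(V,B)$ is a left Hopf algebroid.
   Context: Let $k$ be a commutative ring; algebras are unital associative $k$-algebras. RIGHT BIALGEBROIDS. A right bialgebroid $(V,B,s,t,\Delta,\partial)$ over the algebra $B$ consists of an algebra $V$, algebra maps $s:B\to V$, $t:B^{op}\to V$ with commuting images, and maps $\Delta,\partial$ as follows. Put $b\triangleright v\triangleleft b':=s(b)t(b')v$ and $b\blacktriangleright v\blacktriangleleft b':=v\,t(b)s(b')$; triangles as subscripts indicate the module structure used. $\Delta:V\to V_\blacktriangleleft\otimes_B{}_\blacktriangleright V$, $v\mapsto v^{(1)}\otimes_B v^{(2)}$ (so $vs(b)\otimes_B v'=v\otimes_B v't(b)$), and $\partial:V\to B$ form a $B$-coring on ${}_\blacktriangleright V_\blacktriangleleft$; $\Delta$ is a unital algebra map into the Takeuchi subspace where $\sum_i s(b)v_i\otimes_B v_i'=\sum_i v_i\otimes_B t(b)v'_i$ for all $b$; $\partial(1)=1$, $\partial(vv')=\partial(s(\partial v)v')=\partial(t(\partial v)v')$. Each right $V$-module $M$ is a $B$-bimodule via $b\blacktriangleright m\blacktriangleleft b':=m\,t(b)s(b')$. A right bialgebroid $(V,B)$ is a left Hopf algebroid if the map $\beta_\ell:V_\blacktriangleleft\otimes_B{}_\triangleright V\to V_\blacktriangleleft\otimes_B{}_\blacktriangleright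 V$, $v'\otimes_B v\mapsto v^{(1)}\otimes_B v'v^{(2)}$, is bijective. A left $V$-comodule is a left $B$-module $M$ with left $B$-linear coassociative counital coaction $M\to V_\blacktriangleleft\otimes_B M$, $m\mapsto m^{(-1)}\otimes_B m^{(0)}$; it has the induced right action $mb:=\partial(m^{(-1)}t(b))m^{(0)}$, and $m^{(-1)}\otimes_B m^{(0)}b=s(b)m^{(-1)}\otimes_B m^{(0)}$. ${}^V\mathbf{YD}_V$: objects are right $V$-modules and left $V$-comodules $M$ with coinciding $B$-bimodule structures and $m^{(-1)}v^{(1)}\otimes_B m^{(0)}v^{(2)}=v^{(2)}(mv^{(1)})^{(-1)}\otimes_B(mv^{(1)})^{(0)}$. A monoid in ${}^V\mathbf{YD}_V$ is an object $R$ that is a unital algebra $(R,\cdot)$ with $(r\cdot r')v=(rv^{(1)})\cdot(r'v^{(2)})$, $1_Rv=1_R\blacktriangleleft\partial(v)$; $b(r\cdot r')b'=(br)\cdot(r'b')$, $(rb)\cdot r'=r\cdot(br')$; $(r\cdot r')^{(-1)}\otimes_B(r\cdot r')^{(0)}=r'^{(-1)}r^{(-1)}\otimes_B r^{(0)}\cdot r'^{(0)}$, $1^{(-1)}\otimes_B1^{(0)}=1_V\otimes_B1_R$. It is braided commutative if $r\cdot r'=(r'r^{(-1)})\cdot r^{(0)}$ for all $r,r'$. SMASH PRODUCT. For $R$ a braided commutative monoid in ${}^V\mathbf{YD}_V$, $V\#R$ denotes $V_\blacktriangleleft\otimes_B R$ with product $(v\otimes_B r)(\tilde v\otimes_B r')=v\tilde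 v^{(1)}\otimes_B(r\tilde v^{(2)})\cdot r'$, source $r\mapsto 1\otimes_B r$, target $r\mapsto r^{(-1)}\otimes_B r^{(0)}$, coproduct $v\otimes_B r\mapsto(v^{(1)}\otimes_B1)\otimes_R(v^{(2)}\otimes_B r)$ and counit $v\otimes_B r\mapsto\partial(v)r$.
   Formalization: The induced right action of a left comodule is taken as mb := ∂(t(b)m^(-1))m^(0); the printed ∂(m^(-1)t(b))m^(0) equals bm, which is not a right action for noncommutative B and conflicts with m^(-1)⊗m^(0)b = s(b)m^(-1)⊗m^(0). *)

(* Defs.v *)
From HB Require Import structures.
From mathcomp Require Import all_boot all_order all_algebra.
From mathcomp Require Import boolp.

Set Implicit Arguments.
Unset Strict Implicit.
Unset Printing Implicit Defensive.

Import GRing.Theory.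
Local Open Scope ring_scope.
Local Open Scope quotient_scope.

Declare Scope bialgebroid_scope.
Delimit Scope bialgebroid_scope with bia.
Local Open Scope bialgebroid_scope.

(* M (x)_B N for a k-module M with right action [ract] of B and a k-module N
   with left action [lact] of B.  It is built as a quotient of the monoid of
   finite formal sums of pairs, a pair (m, n) standing for m (x) n. *)
Section Tensor.
Variables (k : comPzRingType) (B : Type) (M N : lmodType k).
Variables (ract : M -> B -> M) (lact : B -> N -> N).

(* The scalar [c] in [tr_balanced] closes the relation under multiplication by
   k, so that the quotient is a k-module for arbitrary [ract] and [lact]; if
   [ract] is k-linear, the case c = 1 gives all the others. *)
Inductive tensor_rel : seq (M * N) -> seq (M * N) -> Prop :=
| tr_refl s : tensor_rel s s
| tr_sym s1 s2 : tensor_rel s1 s2 -> tensor_rel s2 s1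
| tr_trans s1 s2 s3 : tensor_rel s1 s2 -> tensor_rel s2 s3 -> tensor_rel s1 s3
| tr_cat s1 s2 s1' s2' : tensor_rel s1 s1' -> tensor_rel s2 s2' ->
    tensor_rel (s1 ++ s2) (s1' ++ s2')
| tr_comm s1 s2 : tensor_rel (s1 ++ s2) (s2 ++ s1)
| tr_zero n : tensor_rel [:: (0, n)] [::]
| tr_addl m m' n : tensor_rel [:: (m + m', n)] [:: (m, n); (m', n)]
| tr_addr m n n' : tensor_rel [:: (m, n + n')] [:: (m, n); (m, n')]
| tr_scale c m n : tensor_rel [:: (c *: m, n)] [:: (m, c *: n)]
| tr_balanced c m b n : tensor_rel [:: (c *: ract m b, n)] [:: (c *: m, lact b n)].

Definition tensor_relb (s1 s2 : seq (M * N)) : bool := `[< tensor_rel s1 s2 >].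

Lemma tensor_relb_refl : reflexive tensor_relb.
Proof. by move=> s; apply/asboolP; apply: tr_refl. Qed.

Lemma tensor_relb_sym : symmetric tensor_relb.
Proof. by move=> s1 s2; apply/asboolP/asboolP; apply: tr_sym. Qed.

Lemma tensor_relb_trans : transitive tensor_relb.
Proof.
move=> s2 s1 s3 /asboolP h1 /asboolP h2; apply/asboolP.
exact: tr_trans h1 h2.
Qed.

Canonical tensor_equiv :=
  EquivRel tensor_relb tensor_relb_refl tensor_relb_sym tensor_relb_trans.

Definition tensor := {eq_quot tensor_equiv}.
HB.instance Definition _ := Choice.on tensor.
HB.instance Definition _ := Quotient.on tensor.

Definition tsum (s : seq (M * N)) : tensor := \pi_tensor s.

Definition tens (m : M) (n : N) : tensor := tsum [:: (m, n)].

Lemma tsumE s1 s2 : tsum s1 = tsum s2 <-> tensor_rel s1 s2.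
Proof.
split=> [h|h].
  have /eqP/eqmodP/asboolP // : s1 == s2 %[mod tensor] by apply/eqP.
by apply/eqmodP/asboolP.
Qed.

Lemma repr_tsum s : tensor_rel (repr (tsum s)) s.
Proof. by apply/tsumE; rewrite /tsum reprK. Qed.

Lemma tsumP (x : tensor) : exists s, x = tsum s.
Proof. by exists (repr x); rewrite /tsum reprK. Qed.

Definition tscale_seq (c : k) (s : seq (M * N)) : seq (M * N) :=
  [seq (c *: p.1, p.2) | p <- s].

Lemma tensor_rel_scale c s1 s2 :
  tensor_rel s1 s2 -> tensor_rel (tscale_seq c s1) (tscale_seq c s2).
Proof.
elim=> {s1 s2} /=.
- by move=> s; apply: tr_refl.
- by move=> s1 s2 _; apply: tr_sym.
- by move=> s1 s2 s3 _ h1 _; apply: tr_trans.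
- by move=> s1 s2 s1' s2' _ h1 _ h2; rewrite /tscale_seq !map_cat; apply: tr_cat.
- by move=> s1 s2; rewrite /tscale_seq !map_cat; apply: tr_comm.
- by move=> n; rewrite scaler0; apply: tr_zero.
- by move=> m m' n; rewrite scalerDr; apply: tr_addl.
- by move=> m n n'; apply: tr_addr.
- by move=> d m n; rewrite scalerA mulrC -scalerA; apply: tr_scale.
- by move=> d m b n; rewrite !scalerA; apply: tr_balanced.
Qed.

Definition tadd (x y : tensor) : tensor := tsum (repr x ++ repr y).
Definition tscale (c : k) (x : tensor) : tensor := tsum (tscale_seq c (repr x)).
Definition topp (x : tensor) : tensor := tscale (-1) x.
Definition tzero : tensor := tsum [::].

Lemma tadd_tsum s1 s2 : tadd (tsum s1) (tsum s2) = tsum (s1 ++ s2).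
Proof. by apply/tsumE/tr_cat; apply: repr_tsum. Qed.

Lemma tscale_tsum c s : tscale c (tsum s) = tsum (tscale_seq c s).
Proof. by apply/tsumE/tensor_rel_scale/repr_tsum. Qed.

Lemma taddA : associative tadd.
Proof.
move=> x y z.
have [[sx ->] [sy ->] [sz ->]] := And3 (tsumP x) (tsumP y) (tsumP z).
by rewrite !tadd_tsum catA.
Qed.

Lemma taddC : commutative tadd.
Proof.
move=> x y; have [[sx ->] [sy ->]] := conj (tsumP x) (tsumP y).
by rewrite !tadd_tsum; apply/tsumE/tr_comm.
Qed.

Lemma tadd0 : left_id tzero tadd.
Proof. by move=> x; have [s ->] := tsumP x; rewrite tadd_tsum. Qed.

Lemma tscaleDl x : {morph tscale^~ x : c d / c + d >-> tadd c d}.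
Proof.
move=> c d; have [s ->] := tsumP x; rewrite !tscale_tsum tadd_tsum.
apply/tsumE; elim: s => [|[m n] s IHs] /=; first exact: tr_refl.
rewrite scalerDl -cat1s.
apply: tr_trans (tr_cat (tr_addl _ _ _) IHs) _.
set a := (c *: m, n); set b := (d *: m, n).
rewrite -[X in tensor_rel X](catA [:: a] [:: b]).
rewrite -[X in tensor_rel _ X](catA [:: a] (tscale_seq c s) ([:: b] ++ _)).
apply: tr_cat; first exact: tr_refl.
by rewrite !catA; apply: tr_cat; [exact: tr_comm | exact: tr_refl].
Qed.

Lemma tscale0 x : tscale 0 x = tzero.
Proof.
have [s ->] := tsumP x; rewrite tscale_tsum; apply/tsumE.
elim: s => [|[m n] s IHs] /=; first exact: tr_refl.
by rewrite scale0r -cat1s -[[::]]cats0; apply: tr_cat IHs; apply: tr_zero.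
Qed.

Lemma tscale1 : left_id 1 tscale.
Proof.
move=> x; have [s ->] := tsumP x; rewrite tscale_tsum; congr tsum.
by rewrite -[RHS]map_id; apply: eq_map => -[m n] /=; rewrite scale1r.
Qed.

Lemma taddN : left_inverse tzero topp tadd.
Proof.
by move=> x; rewrite -[x in tadd _ x]tscale1 /topp -tscaleDl addNr tscale0.
Qed.

HB.instance Definition _ := GRing.isZmodule.Build tensor taddA taddC tadd0 taddN.

Lemma tscaleA c d x : tscale c (tscale d x) = tscale (c * d) x.
Proof.
have [s ->] := tsumP x; rewrite !tscale_tsum /tscale_seq -map_comp; congr tsum.
by apply: eq_map => -[m n] /=; rewrite scalerA.
Qed.

Lemma tscaleDr : right_distributive tscale +%R.
Proof.
move=> c x y; have [[sx ->] [sy ->]] := conj (tsumP x) (tsumP y).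
have addE s1 s2 : tsum s1 + tsum s2 = tsum (s1 ++ s2) by exact: tadd_tsum.
by rewrite addE !tscale_tsum addE /tscale_seq map_cat.
Qed.

HB.instance Definition _ :=
  GRing.Zmodule_isLmodule.Build k tensor tscaleA tscale1 tscaleDr tscaleDl.

(* Sweedler notation: if x = \sum_i m_i (x) n_i, then [tlift x f] is
   \sum_i f m_i n_i for one chosen such presentation of x.  By [tlift_tens]
   and [tlift_linear] this is the k-linear map induced by [f] when [f] is
   k-bilinear and B-balanced, whatever the choice.  Every formula below is of
   this kind once the axioms of the structures involved hold: the outer sum of
   a Sweedler expression may need the Takeuchi condition, or its analogue for
   coactions, to be balanced. *)
Definition tlift (Z : zmodType) (x : tensor) (f : M -> N -> Z) : Z :=
  \sum_(p <- repr x) f p.1 p.2.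

Definition balanced (Z : lmodType k) (f : M -> N -> Z) : Prop :=
  [/\ forall n, linear (f^~ n), forall m, linear (f m) &
      forall m b n, f (ract m b) n = f m (lact b n)].

Lemma tlift_tsum (Z : lmodType k) (f : M -> N -> Z) s :
  balanced f -> tlift (tsum s) f = \sum_(p <- s) f p.1 p.2.
Proof.
case=> fl fr fb; rewrite /tlift.
have flD m m' n : f (m + m') n = f m n + f m' n.
  by have := fl n 1 m m'; rewrite !scale1r.
have frD m n n' : f m (n + n') = f m n + f m n'.
  by have := fr m 1 n n'; rewrite !scale1r.
have f0l n : f 0 n = 0.
  by apply: (addIr (f 0 n)); rewrite -flD addr0 add0r.
have f0r m : f m 0 = 0.
  by apply: (addIr (f m 0)); rewrite -frD addr0 add0r.
have flZ c m n : f (c *: m) n = c *: f m n.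
  by have := fl n c m 0; rewrite !addr0 f0l addr0.
have frZ c m n : f m (c *: n) = c *: f m n.
  by have := fr m c n 0; rewrite !addr0 f0r addr0.
suff sumE s1 s2 : tensor_rel s1 s2 ->
    \sum_(p <- s1) f p.1 p.2 = \sum_(p <- s2) f p.1 p.2.
  by apply: sumE; apply: repr_tsum.
elim=> {s s1 s2} //=.
- by move=> s1 s2 s3 _ -> _ ->.
- by move=> s1 s2 s1' s2' _ h1 _ h2; rewrite !big_cat /= h1 h2.
- by move=> s1 s2; rewrite !big_cat /= addrC.
- by move=> n; rewrite big_seq1 big_nil /= f0l.
- by move=> m m' n; rewrite big_seq1 big_cons big_seq1 /= flD.
- by move=> m n n'; rewrite big_seq1 big_cons big_seq1 /= frD.
- by move=> c m n; rewrite !big_seq1 /= flZ frZ.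
- by move=> c m b n; rewrite !big_seq1 /= !flZ fb.
Qed.

Lemma tlift_tens (Z : lmodType k) (f : M -> N -> Z) m n :
  balanced f -> tlift (tens m n) f = f m n.
Proof. by move=> fb; rewrite tlift_tsum // big_seq1. Qed.

Lemma tlift_linear (Z : lmodType k) (f : M -> N -> Z) :
  balanced f -> linear (fun x : tensor => tlift x f).
Proof.
move=> fb c x y; have [[sx ->] [sy ->]] := conj (tsumP x) (tsumP y).
have -> : c *: tsum sx + tsum sy = tsum (tscale_seq c sx ++ sy).
  by rewrite -tadd_tsum -tscale_tsum.
rewrite !tlift_tsum // big_cat /= big_map scaler_sumr; congr (_ + _).
apply: eq_bigr => p _ /=; case: fb => fl _ _.
have f0 : f 0 p.2 = 0.
  have := fl p.2 1 0 0; rewrite !scale1r addr0 => h.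
  by apply: (addIr (f 0 p.2)); rewrite add0r -h.
by have := fl p.2 c p.1 0; rewrite !addr0 f0 addr0.
Qed.

End Tensor.

Arguments tens {k B M N ract lact} m n.
Arguments tlift {k B M N ract lact Z} x f.

Notation "\sw_ ( a , b <- x ) F" := (tlift x (fun a b => F))
  (at level 41, F at level 41, a name, b name, x at level 50,
   format "'[' \sw_ ( a ,  b  <-  x ) '/  '  F ']'") : bialgebroid_scope.
Notation "a *t b" := (tens a b) (at level 45, no associativity)
  : bialgebroid_scope.

(* Operations are kept apart from their laws, so that V # R can be written down
   before it is known to satisfy any law.  Contrary to [algType], the zero
   algebra is allowed. *)
Record preAlgebra (k : comPzRingType) := PreAlgebra {
  pa_car :> lmodType k;
  pa_mul : pa_car -> pa_car -> pa_car;
  pa_one : pa_car }.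

Arguments PreAlgebra {k pa_car} pa_mul pa_one.
Arguments pa_mul {k p}.
Arguments pa_one {k p}.

Notation "a *a b" := (pa_mul a b) (at level 40, left associativity)
  : bialgebroid_scope.
Notation "1a" := pa_one : bialgebroid_scope.

Record is_algebra (k : comPzRingType) (A : preAlgebra k) : Prop := {
  alg_linl : forall b : A, linear (fun a : A => a *a b);
  alg_linr : forall a : A, linear (fun b : A => a *a b);
  alg_mulA : forall a b c : A, a *a (b *a c) = a *a b *a c;
  alg_mul1r : forall a : A, 1a *a a = a;
  alg_mulr1 : forall a : A, a *a 1a = a }.

(* [pb_cop] takes its values in the tensor product in which
   v s(b) (x) v' = v (x) v' t(b). *)
Record preBialgebroid (k : comPzRingType) (B : preAlgebra k) := PreBialgebroid {
  pb_tot :> preAlgebra k;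
  pb_src : B -> pb_tot;
  pb_tgt : B -> pb_tot;
  pb_cop : pb_tot -> tensor (fun (v : pb_tot) (b : B) => v *a pb_src b)
                            (fun (b : B) (v : pb_tot) => v *a pb_tgt b);
  pb_cou : pb_tot -> B }.

Arguments pb_src {k B} p.
Arguments pb_tgt {k B} p.
Arguments pb_cop {k B p}.
Arguments pb_cou {k B p}.

Section Bialgebroid.
Variables (k : comPzRingType) (B : preAlgebra k) (V : preBialgebroid B).
Local Notation s := (pb_src V).
Local Notation t := (pb_tgt V).

(* b |> v, and the two sides of b |>> v <<| b' (filled triangles). *)
Definition wtri_l (b : B) (v : V) : V := s b *a v.
Definition btri_l (b : B) (v : V) : V := v *a t b.
Definition btri_r (v : V) (b : B) : V := v *a s b.

(* V (x) V, formed with <<| and |>>. *)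
Definition copTensor : lmodType k := tensor btri_r btri_l.

Definition copTensor_btri_r (x : copTensor) (b : B) : copTensor :=
  \sw_(v, v' <- x) (v *t btri_r v' b).

(* V (x) V (x) V, bracketed to the left. *)
Definition copTensor3 : lmodType k := tensor copTensor_btri_r btri_l.

Record is_right_bialgebroid : Prop := {
  rb_base : is_algebra B;
  rb_tot : is_algebra V;
  rb_src_lin : linear s;
  rb_src_mul : forall b b', s (b *a b') = s b *a s b';
  rb_src_one : s 1a = 1a;
  rb_tgt_lin : linear t;
  rb_tgt_mul : forall b b', t (b *a b') = t b' *a t b;
  rb_tgt_one : t 1a = 1a;
  rb_src_tgt : forall b b', s b *a t b' = t b' *a s b;
  rb_cop_lin : linear (pb_cop : V -> copTensor);
  rb_cop_bimod : forall b b' (v : V),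
    pb_cop (btri_r (btri_l b v) b') =
    \sw_(v1, v2 <- pb_cop v) (btri_l b v1 *t btri_r v2 b') :> copTensor;
  rb_cou_lin : linear (pb_cou : V -> B);
  rb_cou_bimod : forall b b' (v : V),
    pb_cou (btri_r (btri_l b v) b') = b *a pb_cou v *a b';
  rb_coassoc : forall v : V,
    \sw_(v1, v2 <- pb_cop v) (pb_cop v1 *t v2) =
    \sw_(v1, v2 <- pb_cop v) \sw_(v2', v2'' <- pb_cop v2) ((v1 *t v2') *t v2'')
    :> copTensor3;
  rb_coul : forall v : V, \sw_(v1, v2 <- pb_cop v) btri_l (pb_cou v1) v2 = v;
  rb_cour : forall v : V, \sw_(v1, v2 <- pb_cop v) btri_r v1 (pb_cou v2) = v;
  rb_takeuchi : forall b (v : V),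
    \sw_(v1, v2 <- pb_cop v) ((s b *a v1) *t v2) =
    \sw_(v1, v2 <- pb_cop v) (v1 *t (t b *a v2)) :> copTensor;
  rb_cop_one : pb_cop (1a : V) = 1a *t 1a;
  rb_cop_mul : forall v w : V,
    pb_cop (v *a w) =
    \sw_(v1, v2 <- pb_cop v) \sw_(w1, w2 <- pb_cop w) ((v1 *a w1) *t (v2 *a w2))
    :> copTensor;
  rb_cou_one : pb_cou (1a : V) = 1a;
  rb_cou_mul_src : forall v w : V, pb_cou (v *a w) = pb_cou (s (pb_cou v) *a w);
  rb_cou_mul_tgt : forall v w : V, pb_cou (v *a w) = pb_cou (t (pb_cou v) *a w) }.

Definition beta_l (x : tensor btri_r wtri_l) : copTensor :=
  \sw_(v', v <- x) \sw_(v1, v2 <- pb_cop v) (v1 *t (v' *a v2)).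

Definition is_left_Hopf_algebroid : Prop :=
  is_right_bialgebroid /\ bijective beta_l.

End Bialgebroid.

Record preYD (k : comPzRingType) (B : preAlgebra k) (V : preBialgebroid B) :=
  PreYD {
  yd_car :> lmodType k;
  yd_act : yd_car -> V -> yd_car;
  yd_lact : B -> yd_car -> yd_car;
  yd_coact : yd_car -> tensor (@btri_r k B V) yd_lact }.

Arguments yd_act {k B V p}.
Arguments yd_lact {k B V p}.
Arguments yd_coact {k B V p}.

Notation "m <*| v" := (yd_act m v) (at level 40, left associativity)
  : bialgebroid_scope.
Notation "b |*> m" := (yd_lact b m) (at level 35, right associativity)
  : bialgebroid_scope.

Section YetterDrinfeld.
Variables (k : comPzRingType) (B : preAlgebra k) (V : preBialgebroid B).
Variable (M : preYD V).
Local Notation s := (pb_src V).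
Local Notation t := (pb_tgt V).

Record is_right_module : Prop := {
  rm_linl : forall v : V, linear (fun m : M => m <*| v);
  rm_linr : forall m : M, linear (fun v : V => m <*| v);
  rm_mul : forall (m : M) (v w : V), m <*| (v *a w) = m <*| v <*| w;
  rm_one : forall m : M, m <*| 1a = m }.

(* The B-bimodule underlying the right V-module M. *)
Definition act_l (b : B) (m : M) : M := m <*| t b.
Definition act_r (m : M) (b : B) : M := m <*| s b.

Definition coactTensor : lmodType k := tensor (@btri_r k B V) (@yd_lact k B V M).
(* V (x) V (x) M, bracketed to the left. *)
Definition coactTensor3 : lmodType k :=
  tensor (@copTensor_btri_r k B V) (@yd_lact k B V M).

Record is_left_comodule : Prop := {
  lc_linl : forall m : M, linear (fun b : B => b |*> m);
  lc_linr : forall b : B, linear (fun m : M => b |*> m);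
  lc_mul : forall (b b' : B) (m : M), (b *a b') |*> m = b |*> b' |*> m;
  lc_one : forall m : M, 1a |*> m = m;
  lc_coact_lin : linear (yd_coact : M -> coactTensor);
  lc_coact_lact : forall (b : B) (m : M),
    yd_coact (b |*> m) =
    \sw_(v, n <- yd_coact m) (btri_l b v *t n) :> coactTensor;
  lc_coassoc : forall m : M,
    \sw_(v, n <- yd_coact m) (pb_cop v *t n) =
    \sw_(v, n <- yd_coact m) \sw_(v', n' <- yd_coact n) ((v *t v') *t n')
    :> coactTensor3;
  lc_counit : forall m : M, \sw_(v, n <- yd_coact m) (pb_cou v |*> n) = m }.

(* The right B-action induced by the coaction.  The argument of the counit is
   t(b) m^(-1), not m^(-1) t(b): as the counit sends v t(b) to b (counit v),
   the latter order would only return the left action b m. *)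
Definition coact_r (m : M) (b : B) : M :=
  \sw_(v, n <- yd_coact m) (pb_cou (t b *a v) |*> n).

Record is_YD : Prop := {
  yd_mod : is_right_module;
  yd_comod : is_left_comodule;
  yd_bimod_l : forall (b : B) (m : M), b |*> m = act_l b m;
  yd_bimod_r : forall (m : M) (b : B), coact_r m b = act_r m b;
  yd_compat : forall (m : M) (v : V),
    \sw_(x, n <- yd_coact m) \sw_(v1, v2 <- pb_cop v) ((x *a v1) *t (n <*| v2)) =
    \sw_(v1, v2 <- pb_cop v) \sw_(x, n <- yd_coact (m <*| v1)) ((v2 *a x) *t n)
    :> coactTensor }.

End YetterDrinfeld.

Record preYDMonoid (k : comPzRingType) (B : preAlgebra k) (V : preBialgebroid B) :=
  PreYDMonoid {
  ym_obj :> preYD V;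
  ym_mul : ym_obj -> ym_obj -> ym_obj;
  ym_one : ym_obj }.

Section Monoid.
Variables (k : comPzRingType) (B : preAlgebra k) (V : preBialgebroid B).
Variable (R : preYDMonoid V).

Definition ym_alg : preAlgebra k := PreAlgebra (@ym_mul k B V R) (@ym_one k B V R).

Local Notation "1R" := (@ym_one k B V R).
Local Notation "r *r r'" := (@ym_mul k B V R r r')
  (at level 40, left associativity).

Record is_YD_monoid : Prop := {
  ym_YD : is_YD R;
  ym_algebra : is_algebra ym_alg;
  ym_act_mul : forall (r r' : R) (v : V),
    (r *r r') <*| v = \sw_(v1, v2 <- pb_cop v) ((r <*| v1) *r (r' <*| v2));
  ym_act_one : forall v : V, 1R <*| v = act_r 1R (pb_cou v);
  ym_bimod : forall (b b' : B) (r r' : R),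
    act_r (b |*> (r *r r')) b' = (b |*> r) *r (act_r r' b');
  ym_mid : forall (b : B) (r r' : R), act_r r b *r r' = r *r (b |*> r');
  ym_coact_mul : forall r r' : R,
    yd_coact (r *r r') =
    \sw_(x', n' <- yd_coact r') \sw_(x, n <- yd_coact r) ((x' *a x) *t (n *r n'))
    :> coactTensor R;
  ym_coact_one : yd_coact 1R = 1a *t 1R }.

Definition is_braided_commutative : Prop :=
  forall r r' : R, r *r r' = \sw_(x, n <- yd_coact r) ((r' <*| x) *r n).

Definition smash_mul (x y : coactTensor R) : coactTensor R :=
  \sw_(v, r <- x) \sw_(w, r' <- y) \sw_(w1, w2 <- pb_cop w)
    ((v *a w1) *t ((r <*| w2) *r r')).

Definition smash_alg : preAlgebra k :=
  PreAlgebra smash_mul (1a *t 1R : coactTensor R).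

Definition smash_src (r : ym_alg) : smash_alg := 1a *t (r : R).

Definition smash_tgt (r : ym_alg) : smash_alg := yd_coact (r : R).

Definition smash_cop (x : smash_alg) :
    tensor (fun (w : smash_alg) (r : ym_alg) => w *a smash_src r)
           (fun (r : ym_alg) (w : smash_alg) => w *a smash_tgt r) :=
  \sw_(v, r <- (x : coactTensor R)) \sw_(v1, v2 <- pb_cop v)
    (((v1 *t 1R : coactTensor R) : smash_alg) *t
     ((v2 *t r : coactTensor R) : smash_alg)).

Definition smash_cou (x : smash_alg) : ym_alg :=
  \sw_(v, r <- (x : coactTensor R)) (pb_cou v |*> r).

Definition smash : preBialgebroid ym_alg := PreBialgebroid smash_cop smash_cou.

End Monoid.

(* Main.v *)
(* Every identity in V # R is checked on pure tensors, where it reduces to an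
   identity between balanced functions of Sweedler components: coassociativity
   in V or of the coaction, the Takeuchi condition, and the Yetter-Drinfeld
   condition.  Braided commutativity enters only through
   (v # r) tgt(m) = v m^(-1) # m^(0) r.

   For the Hopf part, (v # r) (x)_R w = (v # 1) (x)_R w tgt(r) in the codomain and
   (v # r) (x)_R w = (v # 1) (x)_R src(r) w in the domain, so both sides are
   V (x)_B V (x)_B R and the map of V # R becomes beta_l (x)_B R; it is inverted by
   (v # r) (x)_R w |-> a # 1 (x)_R c # q, where w tgt(r) = u # q and
   a (x)_B c = beta_l^-1(v (x)_B u). *)

Require Import Defs.
From mathcomp Require Import all_boot all_order all_algebra.

Set Implicit Arguments.
Unset Strict Implicit.
Unset Printing Implicit Defensive.

Import GRing.Theory.
Local Open Scope ring_scope.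
Local Open Scope bialgebroid_scope.

(** * Balanced maps and Sweedler sums *)

Section Linear.
Variables (k : comPzRingType) (U Y Z : lmodType k).

Section One.
Variables (f : U -> Z) (hf : linear f).

Lemma linD u v : f (u + v) = f u + f v.
Proof. by have := hf 1 u v; rewrite !scale1r. Qed.

Lemma lin0 : f 0 = 0.
Proof. by apply: (addIr (f 0)); rewrite -linD !add0r. Qed.

Lemma lin_sum I (r : seq I) (F : I -> U) :
  f (\sum_(i <- r) F i) = \sum_(i <- r) f (F i).
Proof. by apply: big_morph; [exact: linD | exact: lin0]. Qed.
End One.

Lemma lin_id : linear (fun u : U => u).
Proof. by move=> c u v. Qed.

Lemma lin_comp (g : Y -> Z) (f : U -> Y) :
  linear g -> linear f -> linear (fun u => g (f u)).
Proof. by move=> hg hf c u v; rewrite hf hg. Qed.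

Lemma lin_big I (r : seq I) (F : I -> U -> Z) :
  (forall i, linear (F i)) -> linear (fun u => \sum_(i <- r) F i u).
Proof.
move=> hF c u v; rewrite scaler_sumr -big_split /=.
by apply: eq_bigr => i _; rewrite hF.
Qed.
End Linear.

Section TensorTheory.
Variables (k : comPzRingType) (B : Type) (M N : lmodType k).
Variables (ract : M -> B -> M) (lact : B -> N -> N).
Local Notation T := (tensor ract lact).

Let tadd_tsum' (s1 s2 : seq (M * N)) :
  (tsum ract lact s1 + tsum ract lact s2 : T) = tsum ract lact (s1 ++ s2).
Proof. exact: tadd_tsum. Qed.

Lemma balanced_tens : balanced ract lact (fun m n => m *t n : T).
Proof.
have DL m m' n : (m + m') *t n = m *t n + m' *t n :> T.
  by rewrite /tens tadd_tsum'; apply/tsumE/tr_addl.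
have DR m n n' : m *t (n + n') = m *t n + m *t n' :> T.
  by rewrite /tens tadd_tsum'; apply/tsumE/tr_addr.
have ZL c m n : (c *: m) *t n = c *: (m *t n) :> T.
  by rewrite /tens /GRing.scale /= tscale_tsum.
have ZR c m n : m *t (c *: n) = c *: (m *t n) :> T.
  by rewrite -ZL; apply/esym/tsumE/tr_scale.
split=> [n c m m' | m c n n' | m b n].
- by rewrite DL ZL.
- by rewrite DR ZR.
(* The generating relation carries a scalar; at c = 1 both scalings are trivial. *)
have := tr_balanced ract lact 1 m b n.
by rewrite !scale1r => h; apply/tsumE.
Qed.

Lemma lin_tensl n : linear (fun m => m *t n : T).
Proof. by case: balanced_tens. Qed.

Lemma lin_tensr m : linear (fun n => m *t n : T).
Proof. by case: balanced_tens. Qed.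

Lemma tens_mid m b n : ract m b *t n = m *t lact b n :> T.
Proof. by case: balanced_tens. Qed.

Lemma eq_tlift (Z : zmodType) (f g : M -> N -> Z) (x : T) :
  (forall m n, f m n = g m n) -> tlift x f = tlift x g.
Proof. by move=> h; apply: eq_bigr => p _. Qed.

(** [tlift] is a finite sum over one chosen presentation of x, so a linear map passes through it
    termwise; balancedness matters only when the presentation changes. *)
Lemma lin_tlift (Y Z : lmodType k) (g : Y -> Z) (f : M -> N -> Y) (x : T) :
  linear g -> g (tlift x f) = \sw_(m, n <- x) g (f m n).
Proof. by move=> hg; rewrite /tlift lin_sum. Qed.

(** Here the variable sits in the tensor, so the presentation varies with it and the integrand must
    be balanced. In [tlift_lin_param] the variable sits in the integrand and linearity is
    termwise. *)
Lemma tlift_lin (Y Z : lmodType k) (g : Y -> T) (f : M -> N -> Z) :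
  linear g -> balanced ract lact f -> linear (fun y => tlift (g y) f).
Proof. by move=> hg hf; exact: lin_comp (tlift_linear hf) hg. Qed.

Lemma tlift_lin_param (Y Z : lmodType k) (x : T) (f : M -> N -> Y -> Z) :
  (forall m n, linear (f m n)) -> linear (fun y => \sw_(m, n <- x) f m n y).
Proof. by move=> hf; apply: lin_big. Qed.

Lemma tliftE (x : T) : \sw_(m, n <- x) (m *t n) = x :> T.
Proof.
have [s ->] := tsumP x; rewrite tlift_tsum; last exact: balanced_tens.
elim: s => [|p s IHs]; first by rewrite big_nil.
by rewrite big_cons IHs [LHS]tadd_tsum'; case: p.
Qed.

Lemma tensor_ext (Z : lmodType k) (f g : T -> Z) :
  linear f -> linear g -> (forall m n, f (m *t n) = g (m *t n)) -> f =1 g.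
Proof.
move=> hf hg h x; rewrite -[x]tliftE !(lin_tlift _ _ hf, lin_tlift _ _ hg).
exact: eq_tlift.
Qed.

End TensorTheory.

Lemma tlift_exch (k : comPzRingType) (B B' : Type) (M N M' N' : lmodType k)
    (ra : M -> B -> M) (la : B -> N -> N)
    (ra' : M' -> B' -> M') (la' : B' -> N' -> N') (Z : zmodType)
    (x : tensor ra la) (y : tensor ra' la') (f : M -> N -> M' -> N' -> Z) :
  \sw_(m, n <- x) \sw_(m', n' <- y) f m n m' n' =
  \sw_(m', n' <- y) \sw_(m, n <- x) f m n m' n'.
Proof. exact: exchange_big. Qed.

Lemma tlift_tlift (k : comPzRingType) (B B' : Type) (M N M' N' : lmodType k)
    (ra : M -> B -> M) (la : B -> N -> N)
    (ra' : M' -> B' -> M') (la' : B' -> N' -> N') (Z : lmodType k)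
    (x : tensor ra la) (g : M -> N -> tensor ra' la') (f : M' -> N' -> Z) :
  balanced ra' la' f ->
  tlift (tlift x g) f = \sw_(m, n <- x) tlift (g m n) f.
Proof. by move=> hf; rewrite (lin_tlift _ _ (tlift_linear hf)). Qed.

(** * Linearity of composite expressions *)

Section TensorLinear.
Variables (k : comPzRingType) (Y : lmodType k).

Lemma lin_alg_mull (A : preAlgebra k) (hA : is_algebra A) (f : Y -> A) a :
  linear f -> linear (fun y => f y *a a).
Proof. exact: lin_comp (alg_linl hA a). Qed.

Lemma lin_alg_mulr (A : preAlgebra k) (hA : is_algebra A) (f : Y -> A) a :
  linear f -> linear (fun y => a *a f y).
Proof. exact: lin_comp (alg_linr hA a). Qed.

Variables (B : Type) (M N : lmodType k).
Variables (ract : M -> B -> M) (lact : B -> N -> N).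

Lemma lin_tens_l (f : Y -> M) n :
  linear f -> linear (fun y => f y *t n : tensor ract lact).
Proof. exact: lin_comp (lin_tensl _ _ _). Qed.

Lemma lin_tens_r (f : Y -> N) m :
  linear f -> linear (fun y => m *t f y : tensor ract lact).
Proof. exact: lin_comp (lin_tensr _ _ _). Qed.
End TensorLinear.

(** * Sweedler calculus in a right bialgebroid *)

Section RightBialgebroid.
Variables (k : comPzRingType) (B : preAlgebra k) (V : preBialgebroid B).
Variables (hV : is_right_bialgebroid V).

Local Notation s := (pb_src V).
Local Notation t := (pb_tgt V).
Local Notation cop := (@pb_cop k B V).
Local Notation cou := (@pb_cou k B V).
Local Notation T2 := (tensor (@btri_r k B V) (@btri_l k B V)).
Local Notation bal2 := (balanced (@btri_r k B V) (@btri_l k B V)).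

Let hA := rb_tot hV.
Let mulA := alg_mulA hA.
Let mul1 := alg_mul1r hA.
Let mulr1 := alg_mulr1 hA.

Lemma lin_src (Y : lmodType k) (f : Y -> B) : linear f -> linear (fun y => s (f y)).
Proof. exact: lin_comp (rb_src_lin hV). Qed.

Lemma lin_tgt (Y : lmodType k) (f : Y -> B) : linear f -> linear (fun y => t (f y)).
Proof. exact: lin_comp (rb_tgt_lin hV). Qed.

Lemma lin_cop (Y : lmodType k) (f : Y -> V) :
  linear f -> linear (fun y => cop (f y) : T2).
Proof. exact: lin_comp (rb_cop_lin hV). Qed.

Lemma lin_cou (Y : lmodType k) (f : Y -> V) : linear f -> linear (fun y => cou (f y)).
Proof. exact: lin_comp (rb_cou_lin hV). Qed.

(** The maps that factor through V (x) V (x) N bracketed to the left. N is V for coassociativity of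
    the coproduct and R for that of the coaction. *)
Record tribalanced (N Z : lmodType k) (lact : B -> N -> N) (F : V -> V -> N -> Z) := {
  tri_lin1 : forall b n, linear (fun a => F a b n);
  tri_lin2 : forall a n, linear (fun b => F a b n);
  tri_lin3 : forall a b, linear (fun n => F a b n);
  tri_mid1 : forall a c b n, F (a *a s c) b n = F a (b *a t c) n;
  tri_mid2 : forall a b c n, F a (b *a s c) n = F a b (lact c n) }.

Section Tribalanced.
Variables (N Z : lmodType k) (lact : B -> N -> N) (F : V -> V -> N -> Z).
Hypothesis hF : tribalanced lact F.

Lemma tri_bal_in n : bal2 (fun a b => F a b n).
Proof.
by split=> [b | a | a c b]; [apply: tri_lin1 hF _ _ | apply: tri_lin2 hF _ _ |
  apply: tri_mid1 hF _ _ _ _].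
Qed.

Lemma tri_bal_out :
  balanced (@copTensor_btri_r k B V) lact (fun x n => \sw_(a, b <- x) F a b n).
Proof.
split=> [n | x | x c n].
- exact: tlift_lin (@lin_id _ _) (tri_bal_in n).
- by apply: tlift_lin_param => a b; apply: tri_lin3 hF _ _.
rewrite tlift_tlift; last exact: tri_bal_in.
by apply: eq_tlift => a b; rewrite tlift_tens ?(tri_mid2 hF) //; apply: tri_bal_in.
Qed.

Definition tri_eval (z : tensor (@copTensor_btri_r k B V) lact) : Z :=
  \sw_(x, n <- z) \sw_(a, b <- x) F a b n.

Lemma tri_eval_lin : linear tri_eval.
Proof. exact: tlift_lin (@lin_id _ _) tri_bal_out. Qed.

Lemma tri_eval_tens x n : tri_eval (x *t n) = \sw_(a, b <- x) F a b n.
Proof. by rewrite /tri_eval tlift_tens //; apply: tri_bal_out. Qed.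

Lemma tri_eval_tens2 a b n : tri_eval ((a *t b) *t n) = F a b n.
Proof. by rewrite tri_eval_tens tlift_tens //; apply: tri_bal_in. Qed.
End Tribalanced.

(** Applying [tri_eval F] to the axiom turns an equation in a quotient into a rebracketing rule for
    Sweedler sums inside any tribalanced expression. *)
Lemma cop_coassoc (Z : lmodType k) (F : V -> V -> V -> Z) v :
  tribalanced (@btri_l k B V) F ->
  \sw_(v1, v2 <- cop v) \sw_(a, b <- cop v1) F a b v2 =
  \sw_(v1, v2 <- cop v) \sw_(a, b <- cop v2) F v1 a b.
Proof.
move=> hF; have := congr1 (tri_eval F) (rb_coassoc hV v).
rewrite !(lin_tlift _ _ (tri_eval_lin hF)) => h.
transitivity (\sw_(v1, v2 <- cop v)
    tri_eval F (cop v1 *t v2 : tensor (@copTensor_btri_r k B V) (@btri_l k B V))).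
  by apply: eq_tlift => v1 v2; rewrite (tri_eval_tens hF).
rewrite h; apply: eq_tlift => v1 v2.
rewrite (lin_tlift _ _ (tri_eval_lin hF)).
by apply: eq_tlift => a b; rewrite (tri_eval_tens2 hF).
Qed.

Section CopEval.
Variables (Z : lmodType k) (F : V -> V -> Z) (hF : bal2 F).

Lemma cop_mul v w : tlift (cop (v *a w)) F =
  \sw_(v1, v2 <- cop v) \sw_(w1, w2 <- cop w) F (v1 *a w1) (v2 *a w2).
Proof.
rewrite (rb_cop_mul hV) tlift_tlift //; apply: eq_tlift => v1 v2.
by rewrite tlift_tlift //; apply: eq_tlift => w1 w2; rewrite tlift_tens.
Qed.

Lemma cop_one : tlift (cop 1a) F = F 1a 1a.
Proof. by rewrite (rb_cop_one hV) tlift_tens. Qed.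

Lemma cop_mul_src_tgt v b c : tlift (cop (v *a t b *a s c)) F =
  \sw_(v1, v2 <- cop v) F (v1 *a t b) (v2 *a s c).
Proof.
rewrite (rb_cop_bimod hV) tlift_tlift //; apply: eq_tlift => v1 v2.
by rewrite tlift_tens.
Qed.

Lemma cop_takeuchi b v :
  \sw_(v1, v2 <- cop v) F (s b *a v1) v2 = \sw_(v1, v2 <- cop v) F v1 (t b *a v2).
Proof.
have := congr1 (fun x => tlift x F) (rb_takeuchi hV b v).
rewrite !tlift_tlift // => h; transitivity
  (\sw_(v1, v2 <- cop v) tlift ((s b *a v1) *t v2 : T2) F).
  by apply: eq_tlift => v1 v2; rewrite tlift_tens.
by rewrite h; apply: eq_tlift => v1 v2; rewrite tlift_tens.
Qed.

End CopEval.

Section CopEvalRight.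
Variables (Z : lmodType k) (F : V -> V -> Z) (hF : bal2 F).

Lemma cop_mulr_src v c : tlift (cop (v *a s c)) F =
  \sw_(v1, v2 <- cop v) F v1 (v2 *a s c).
Proof.
have := cop_mul_src_tgt hF v 1a c; rewrite (rb_tgt_one hV) mulr1 => ->.
by apply: eq_tlift => v1 v2; rewrite mulr1.
Qed.

Lemma cop_mulr_tgt v b : tlift (cop (v *a t b)) F =
  \sw_(v1, v2 <- cop v) F (v1 *a t b) v2.
Proof.
have := cop_mul_src_tgt hF v b 1a; rewrite (rb_src_one hV) mulr1 => ->.
by apply: eq_tlift => v1 v2; rewrite mulr1.
Qed.

End CopEvalRight.

(** Write s(b) = 1 s(b); the coproduct is a B-bimodule map for the filled triangles and sends 1 to 1
    (x) 1. *)
Lemma cop_src b : cop (s b) = 1a *t s b :> T2.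
Proof.
rewrite -(tliftE (cop (s b) : T2)) -{1}[s b]mul1 cop_mulr_src; last exact: balanced_tens.
rewrite (cop_one (F := fun a c => a *t (c *a s b) : T2)) ?mul1 //.
split=> [n | m | m c n]; first exact: lin_tensl.
  by apply: lin_tens_r; apply: alg_linl hA _.
by rewrite (tens_mid (@btri_r k B V)) /btri_l -!mulA (rb_src_tgt hV).
Qed.

Lemma cop_tgt b : cop (t b) = t b *t 1a :> T2.
Proof.
rewrite -(tliftE (cop (t b) : T2)) -{1}[t b]mul1 cop_mulr_tgt; last exact: balanced_tens.
rewrite (cop_one (F := fun a c => (a *a t b) *t c : T2)) ?mul1 //.
split=> [n | m | m c n]; last 1 first.
- by rewrite -(tens_mid (@btri_r k B V)) /btri_r -!mulA (rb_src_tgt hV).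
- by apply: lin_tens_l; apply: alg_linl hA _.
exact: lin_tensr.
Qed.

Section CopEvalLeft.
Variables (Z : lmodType k) (F : V -> V -> Z) (hF : bal2 F).

Lemma balanced_mull a b : bal2 (fun v w => F (a *a v) (b *a w)).
Proof.
have [F1 F2 F3] := hF; split=> [w | v | v c w].
- by apply: (lin_comp (F1 _)); apply: lin_alg_mulr hA _ _ (@lin_id _ _).
- by apply: (lin_comp (F2 _)); apply: lin_alg_mulr hA _ _ (@lin_id _ _).
by rewrite /btri_r /btri_l !mulA F3.
Qed.

(** The Takeuchi condition makes the outer sum balanced: an s(c) landing on the left of w1 becomes
    t(c) on the left of w2. *)
Lemma balanced_mulr_cop w :
  bal2 (fun a b => \sw_(w1, w2 <- cop w) F (a *a w1) (b *a w2)).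
Proof.
have [F1 F2 F3] := hF; split=> [b | a | a c b].
- apply: tlift_lin_param => w1 w2.
  by apply: (lin_comp (F1 _)); apply: lin_alg_mull hA _ _ (@lin_id _ _).
- apply: tlift_lin_param => w1 w2.
  by apply: (lin_comp (F2 _)); apply: lin_alg_mull hA _ _ (@lin_id _ _).
transitivity (\sw_(w1, w2 <- cop w) F (a *a (s c *a w1)) (b *a w2)).
  by apply: eq_tlift => w1 w2; rewrite mulA.
rewrite (cop_takeuchi (balanced_mull a b)); apply: eq_tlift => w1 w2.
by rewrite mulA.
Qed.

Lemma cop_mull_tgt b v :
  tlift (cop (t b *a v)) F = \sw_(v1, v2 <- cop v) F (t b *a v1) v2.
Proof.
rewrite (cop_mul hF) cop_tgt tlift_tens; last exact: balanced_mulr_cop.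
by apply: eq_tlift => v1 v2; rewrite mul1.
Qed.

Lemma cop_mull_src b v :
  tlift (cop (s b *a v)) F = \sw_(v1, v2 <- cop v) F v1 (s b *a v2).
Proof.
rewrite (cop_mul hF) cop_src tlift_tens; last exact: balanced_mulr_cop.
by apply: eq_tlift => v1 v2; rewrite mul1.
Qed.

End CopEvalLeft.

End RightBialgebroid.

(** * Sweedler calculus in a Yetter-Drinfeld monoid *)

Section YetterDrinfeldMonoid.
Variables (k : comPzRingType) (B : preAlgebra k) (V : preBialgebroid B).
Variables (R : preYDMonoid V).
Variables (hV : is_right_bialgebroid V) (hR : is_YD_monoid R).

Local Notation s := (pb_src V).
Local Notation t := (pb_tgt V).
Local Notation cop := (@pb_cop k B V).
Local Notation cou := (@pb_cou k B V).
Local Notation coact := (@yd_coact k B V R).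
Local Notation "1R" := (@ym_one k B V R).
Local Notation "r *r r'" := (@ym_mul k B V R r r') (at level 40, left associativity).
Local Notation balR := (balanced (@btri_r k B V) (@yd_lact k B V R)).
Local Notation W := (coactTensor R).

Let hY := ym_YD hR.
Let hM := yd_mod hY.
Let hC := yd_comod hY.
Let hRa := ym_algebra hR.

Lemma lin_rmul_l (Y : lmodType k) (f : Y -> R) r :
  linear f -> linear (fun y => f y *r r).
Proof. exact: lin_comp (alg_linl hRa r). Qed.

Lemma lin_rmul_r (Y : lmodType k) (f : Y -> R) r :
  linear f -> linear (fun y => r *r f y).
Proof. exact: lin_comp (alg_linr hRa r). Qed.

Lemma lin_act_l (Y : lmodType k) (f : Y -> R) v :
  linear f -> linear (fun y => f y <*| v).
Proof. exact: lin_comp (rm_linl hM v). Qed.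

Lemma lin_act_r (Y : lmodType k) (f : Y -> V) (r : R) :
  linear f -> linear (fun y => r <*| f y).
Proof. exact: lin_comp (rm_linr hM r). Qed.

Lemma lin_lact_l (Y : lmodType k) (f : Y -> B) (r : R) :
  linear f -> linear (fun y => f y |*> r).
Proof. exact: lin_comp (lc_linl hC r). Qed.

Lemma lin_lact_r (Y : lmodType k) (f : Y -> R) b :
  linear f -> linear (fun y => b |*> f y).
Proof. exact: lin_comp (lc_linr hC b). Qed.

Lemma lin_coact (Y : lmodType k) (f : Y -> R) :
  linear f -> linear (fun y => coact (f y) : W).
Proof. exact: lin_comp (lc_coact_lin hC). Qed.

Lemma rmulA r1 r2 r3 : r1 *r (r2 *r r3) = r1 *r r2 *r r3.
Proof. exact: alg_mulA hRa _ _ _. Qed.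

Lemma rmul1 r : 1R *r r = r.
Proof. exact: alg_mul1r hRa _. Qed.

Lemma rmulr1 r : r *r 1R = r.
Proof. exact: alg_mulr1 hRa _. Qed.

Lemma lactE b (r : R) : b |*> r = r <*| t b.
Proof. exact: yd_bimod_l hY _ _. Qed.

Lemma actA (r : R) v w : r <*| v <*| w = r <*| (v *a w).
Proof. by rewrite (rm_mul hM). Qed.

Lemma rmul_tgt b r r' : (r *r r') <*| t b = (r <*| t b) *r r'.
Proof.
have := ym_bimod hR b 1a r r'.
by rewrite /act_r (rb_src_one hV) !(rm_one hM) !lactE.
Qed.

Lemma rmul_mid b r r' : (r <*| s b) *r r' = r *r (r' <*| t b).
Proof. by rewrite -lactE; apply: ym_mid hR _ _ _. Qed.

Lemma one_act v : 1R <*| v = 1R <*| s (cou v).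
Proof. exact: ym_act_one hR _. Qed.

Lemma tens_src v b (r : R) : (v *a s b) *t r = v *t (r <*| t b) :> W.
Proof. by rewrite -lactE; apply: (tens_mid (@btri_r k B V) (@yd_lact k B V R)). Qed.

Section CoactEval.
Variables (Z : lmodType k) (F : V -> R -> Z) (hF : balR F).

Lemma coact_tgt b m :
  tlift (coact (m <*| t b)) F = \sw_(x, n <- coact m) F (x *a t b) n.
Proof.
rewrite -lactE (lc_coact_lact hC) tlift_tlift //.
by apply: eq_tlift => x n; rewrite tlift_tens.
Qed.

Lemma coact_act m v :
  \sw_(x, n <- coact m) \sw_(v1, v2 <- cop v) F (x *a v1) (n <*| v2) =
  \sw_(v1, v2 <- cop v) \sw_(x, n <- coact (m <*| v1)) F (v2 *a x) n.
Proof.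
have h := congr1 (fun z => tlift z F) (yd_compat hY m v).
rewrite !tlift_tlift // in h.
transitivity (\sw_(x, n <- coact m)
  tlift (\sw_(v1, v2 <- cop v) ((x *a v1) *t (n <*| v2) : W)) F).
  apply: eq_tlift => x n; rewrite tlift_tlift //.
  by apply: eq_tlift => v1 v2; rewrite tlift_tens.
rewrite h; apply: eq_tlift => v1 v2; rewrite tlift_tlift //.
by apply: eq_tlift => x n; rewrite tlift_tens.
Qed.

End CoactEval.

Lemma coact_coassoc (Z : lmodType k) (F : V -> V -> R -> Z) m :
  tribalanced (@yd_lact k B V R) F ->
  \sw_(x, n <- coact m) \sw_(a, b <- cop x) F a b n =
  \sw_(x, n <- coact m) \sw_(y, n' <- coact n) F x y n'.
Proof.
move=> hF; have := congr1 (tri_eval F) (lc_coassoc hC m).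
rewrite !(lin_tlift _ _ (tri_eval_lin hF)) => h.
transitivity (\sw_(x, n <- coact m)
    tri_eval F (cop x *t n : tensor (@copTensor_btri_r k B V) (@yd_lact k B V R))).
  by apply: eq_tlift => x n; rewrite (tri_eval_tens hF).
rewrite h; apply: eq_tlift => x n.
rewrite (lin_tlift _ _ (tri_eval_lin hF)).
by apply: eq_tlift => a b; rewrite (tri_eval_tens2 hF).
Qed.

(** Since cou(v x) = cou(t(cou v) x), the sum is the right action of cou v induced by the coaction,
    and this coincides with the one given by s. *)
Lemma coact_cou (m : R) v :
  \sw_(x, n <- coact m) (cou (v *a x) |*> n) = m <*| s (cou v).
Proof.
rewrite -[RHS](yd_bimod_r hY) /coact_r.
by apply: eq_tlift => x n; rewrite (rb_cou_mul_tgt hV).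
Qed.

End YetterDrinfeldMonoid.

(* Hook of [lin] for [smash_mul], whose bilinearity is itself proved with [lin]. *)
Ltac lin_smash := idtac.

(** Recursion on the head symbol of the body, for a variable occurring in a single argument. When it
    occurs in the tensor of a [tlift], balancedness of the integrand is left as a goal. *)
Ltac lin :=
  (* Eta-expansion, so that the patterns below always meet an abstraction. *)
  lazymatch goal with
  | |- @GRing.linear_for ?R ?U ?Z ?sc ?f =>
      change (@GRing.linear_for R U Z sc (fun y => f y)); cbv beta
  | |- _ => idtac
  end;
  lazymatch goal with
  | |- GRing.linear_for _ (fun y => y) => exact (@lin_id _ _)
  | |- GRing.linear_for _ (fun y => tens (@?a y) (@?b y)) =>
      first [ refine (lin_tens_l _ _ _ _) | refine (lin_tens_r _ _ _ _) ]; lin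
  | |- GRing.linear_for _ (fun y => pa_mul (@?a y) (@?b y)) =>
      first [ refine (lin_alg_mull (rb_tot _) _ _) | refine (lin_alg_mulr (rb_tot _) _ _) ];
      [ assumption | lin ]
  | |- GRing.linear_for _ (fun y => ym_mul (@?a y) (@?b y)) =>
      first [ refine (lin_rmul_l _ _ _) | refine (lin_rmul_r _ _ _) ]; [ assumption | lin ]
  | |- GRing.linear_for _ (fun y => yd_act (@?a y) (@?b y)) =>
      first [ refine (lin_act_l _ _ _) | refine (lin_act_r _ _ _) ]; [ assumption | lin ]
  | |- GRing.linear_for _ (fun y => yd_lact (@?a y) (@?b y)) =>
      first [ refine (lin_lact_l _ _ _) | refine (lin_lact_r _ _ _) ]; [ assumption | lin ]
  | |- GRing.linear_for _ (fun y => pb_src _ (@?a y)) =>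
      refine (lin_src _ _); [ assumption | lin ]
  | |- GRing.linear_for _ (fun y => pb_tgt _ (@?a y)) =>
      refine (lin_tgt _ _); [ assumption | lin ]
  | |- GRing.linear_for _ (fun y => pb_cou (@?a y)) =>
      refine (lin_cou _ _); [ assumption | lin ]
  | |- GRing.linear_for _ (fun y => pb_cop (@?a y)) =>
      refine (lin_cop _ _); [ assumption | lin ]
  | |- GRing.linear_for _ (fun y => yd_coact (@?a y)) =>
      refine (lin_coact _ _); [ assumption | lin ]
  | |- GRing.linear_for _ (fun y => tlift (@?a y) (@?b y)) =>
      first [ refine (tlift_lin_param _ _); let m := fresh "m" in let n := fresh "n" in
              intros m n; lin
            | refine (tlift_lin _ _); [ lin | ] ]
  | |- _ => lin_smash
  end.

(** * The Hopf map *)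

Section HopfMap.
Variables (k : comPzRingType) (B : preAlgebra k) (V : preBialgebroid B).
Variables (hV : is_right_bialgebroid V).

Local Notation s := (pb_src V).
Local Notation t := (pb_tgt V).
Local Notation cop := (@pb_cop k B V).
Local Notation bal2 := (balanced (@btri_r k B V) (@btri_l k B V)).
Local Notation balD := (balanced (@btri_r k B V) (@wtri_l k B V)).
Local Notation T2 := (tensor (@btri_r k B V) (@btri_l k B V)).
Local Notation D := (tensor (@btri_r k B V) (@wtri_l k B V)).

Let mulA := alg_mulA (rb_tot hV).

Lemma beta_bal_in v' : bal2 (fun v1 v2 => v1 *t (v' *a v2) : T2).
Proof.
split=> [v | v | v b w]; [by lin | by lin | ].
by rewrite (tens_mid (@btri_r k B V)) /btri_l mulA.
Qed.

(** The coproduct of s(b) v is v1 (x) s(b) v2, which puts s(b) between v' and v2, just where v' s(b)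
    has it. *)
Lemma beta_bal : balD (fun v' v => \sw_(v1, v2 <- cop v) (v1 *t (v' *a v2)) : T2).
Proof.
split=> [v | v' | v' b v]; [by lin | by lin; exact: beta_bal_in | ].
rewrite /wtri_l (cop_mull_src hV (beta_bal_in _)); apply: eq_tlift => v1 v2.
by rewrite /btri_r mulA.
Qed.

Lemma beta_lin : linear (@beta_l k B V).
Proof. exact: tlift_lin (@lin_id _ _) beta_bal. Qed.

Lemma beta_tens v' v :
  beta_l (v' *t v : D) = \sw_(v1, v2 <- cop v) (v1 *t (v' *a v2)) :> T2.
Proof. exact: (tlift_tens _ _ beta_bal). Qed.

Lemma copTensor_btri_r_bal b : bal2 (fun v v' => v *t btri_r v' b : T2).
Proof.
rewrite /btri_r; split=> [v | v | v c w]; [by lin | by lin | ].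
by rewrite (tens_mid (@btri_r k B V)) /btri_l -!mulA (rb_src_tgt hV).
Qed.

Definition dom_btri_r (x : D) b : D := \sw_(v', v <- x) (v' *t btri_r v b).

Lemma dom_btri_r_bal b : balD (fun v' v => v' *t btri_r v b : D).
Proof.
rewrite /btri_r; split=> [v | v | v c w]; [by lin | by lin | ].
by rewrite (tens_mid (@btri_r k B V)) /wtri_l -!mulA.
Qed.

(** Right B-linearity is what allows [beta_l] to be tensored over B with R; an inverse inherits it
    in [gamma_btri_r]. *)
Lemma beta_dom_btri_r x b : beta_l (dom_btri_r x b) = copTensor_btri_r (beta_l x) b.
Proof.
move: x; apply tensor_ext.
- apply: (lin_comp beta_lin); exact: tlift_lin (@lin_id _ _) (dom_btri_r_bal b).
- exact: tlift_lin beta_lin (copTensor_btri_r_bal b).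
move=> v' v; rewrite /dom_btri_r (tlift_tens _ _ (dom_btri_r_bal b)) !beta_tens.
rewrite /copTensor_btri_r (tlift_tlift _ _ (copTensor_btri_r_bal b)).
rewrite {1}/btri_r (cop_mulr_src hV (beta_bal_in _)); apply: eq_tlift => v1 v2.
by rewrite (tlift_tens _ _ (copTensor_btri_r_bal b)) /btri_r mulA.
Qed.

End HopfMap.

(** * The smash product *)

Section Smash.
Variables (k : comPzRingType) (B : preAlgebra k) (V : preBialgebroid B).
Variables (R : preYDMonoid V).
Variables (hV : is_right_bialgebroid V) (hR : is_YD_monoid R).

Local Notation s := (pb_src V).
Local Notation t := (pb_tgt V).
Local Notation cop := (@pb_cop k B V).
Local Notation cou := (@pb_cou k B V).
Local Notation coact := (@yd_coact k B V R).
Local Notation "1R" := (@ym_one k B V R).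
Local Notation "r *r r'" := (@ym_mul k B V R r r') (at level 40, left associativity).
Local Notation balR := (balanced (@btri_r k B V) (@yd_lact k B V R)).
Local Notation bal2 := (balanced (@btri_r k B V) (@btri_l k B V)).
Local Notation W := (coactTensor R).
Local Notation "x ** y" := (@smash_mul k B V R x y) (at level 40, left associativity).

(** The actions of R on V # R, spelled out through [smash_mul]. They are convertible with those of
    [smash R], and this is the form that [lin] and the rewriting steps recognise. *)
Local Notation wr := (fun (w : W) (r : R) => w ** (1a *t r)).
Local Notation wl := (fun (r : R) (w : W) => w ** coact r).
Local Notation W2 := (tensor wr wl).
Local Notation scop := (@smash_cop k B V R : W -> W2).
Local Notation scou := (@smash_cou k B V R : W -> R).

Let mulA := alg_mulA (rb_tot hV).
Let mul1 := alg_mul1r (rb_tot hV).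
Let mulr1 := alg_mulr1 (rb_tot hV).

(** * The product of V # R *)

Lemma smash_bal1 v r r' :
  bal2 (fun w1 w2 => (v *a w1) *t ((r <*| w2) *r r') : W).
Proof.
split=> [w2 | w1 | w1 b w2]; [by lin | by lin | ].
by rewrite /btri_r /btri_l mulA (tens_src hR) (rmul_tgt hV hR) (actA hR).
Qed.

Lemma smash_bal2 v r :
  balR (fun w r' => \sw_(w1, w2 <- cop w) ((v *a w1) *t ((r <*| w2) *r r')) : W).
Proof.
split=> [r' | w | w b r']; [lin; exact: smash_bal1 | by lin | ].
rewrite /btri_r (cop_mulr_src hV (smash_bal1 _ _ _)); apply: eq_tlift => w1 w2.
by rewrite -(actA hR) (rmul_mid hR) (lactE hR).
Qed.

(** The Takeuchi condition in V trades s(b) w1 (x) w2 for w1 (x) t(b) w2, which carries b from v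
    over to r. *)
Lemma smash_bal3 (y : W) :
  balR (fun v r => \sw_(w, r' <- y) \sw_(w1, w2 <- cop w)
     ((v *a w1) *t ((r <*| w2) *r r')) : W).
Proof.
split=> [r | v | v b r]; [by lin | by lin | ].
apply: eq_tlift => w r'; rewrite (lactE hR).
have := cop_takeuchi hV (smash_bal1 v r r') b w.
rewrite /btri_r => h; transitivity (\sw_(w1, w2 <- cop w)
  ((v *a (s b *a w1)) *t ((r <*| w2) *r r') : W)).
  by apply: eq_tlift => w1 w2; rewrite mulA.
by rewrite h; apply: eq_tlift => w1 w2; rewrite (actA hR).
Qed.

Lemma smash_linl (y : W) : linear (fun x : W => x ** y).
Proof. exact: tlift_lin (@lin_id _ _) (smash_bal3 y). Qed.

Lemma smash_linr (x : W) : linear (fun y : W => x ** y).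
Proof. by rewrite /smash_mul; lin; exact: smash_bal2. Qed.

Lemma lin_smash_l (Y : lmodType k) (f : Y -> W) x :
  linear f -> linear (fun y => f y ** x).
Proof. exact: lin_comp (smash_linl x). Qed.

Lemma lin_smash_r (Y : lmodType k) (f : Y -> W) x :
  linear f -> linear (fun y => x ** f y).
Proof. exact: lin_comp (smash_linr x). Qed.

Ltac lin_smash ::=
  lazymatch goal with
  | |- GRing.linear_for _ (fun y => smash_mul (@?a y) (@?b y)) =>
      first [ refine (lin_smash_l _ _) | refine (lin_smash_r _ _) ]; lin
  | |- _ => idtac
  end.

Lemma smash_tens v r w r' : (v *t r) ** (w *t r') =
  \sw_(w1, w2 <- cop w) ((v *a w1) *t ((r <*| w2) *r r')) :> W.
Proof.
rewrite /smash_mul tlift_tens; last exact: smash_bal3.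
by rewrite tlift_tens //; apply: smash_bal2.
Qed.

(** Multiplicativity of the coproduct splits w u1 on one side; the action of u2 on a product in R
    splits u2 on the other. Coassociativity at u matches the two. *)
Lemma smash_assoc (a b c : W) : a ** (b ** c) = a ** b ** c.
Proof.
move: a; apply tensor_ext; [by lin | by lin | move=> v r].
move: b; apply tensor_ext; [by lin | by lin | move=> w r'].
move: c; apply tensor_ext; [by lin | by lin | move=> u r''].
rewrite !smash_tens.
rewrite (lin_tlift _ _ (smash_linr _)) (lin_tlift _ _ (smash_linl _)).
transitivity (\sw_(w1, w2 <- cop w) \sw_(u1, u2 <- cop u) \sw_(a, b <- cop u1)
   ((v *a w1 *a a) *t ((r <*| (w2 *a b)) *r ((r' <*| u2) *r r'')) : W)).
  rewrite tlift_exch; apply: eq_tlift => u1 u2; rewrite smash_tens.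
  rewrite (cop_mul hV (smash_bal1 _ _ _)); apply: eq_tlift => w1 w2.
  by apply: eq_tlift => a b; rewrite mulA.
apply: eq_tlift => w1 w2; rewrite smash_tens.
rewrite (cop_coassoc (F := fun a b c =>
   (v *a w1 *a a) *t ((r <*| (w2 *a b)) *r ((r' <*| c) *r r'')) : W) hV); last first.
  split=> *; [by lin | by lin | by lin | |].
    by rewrite mulA (tens_src hR) (rmul_tgt hV hR) (actA hR) mulA.
  by rewrite mulA -(actA hR) (rmul_mid hR) (rmul_tgt hV hR) (actA hR).
apply: eq_tlift => u1 u2; rewrite (ym_act_mul hR).
rewrite (lin_tlift (g := fun z => (v *a w1 *a u1) *t (z *r r'') : W)); last by lin.
by apply: eq_tlift => a b; rewrite (actA hR) (rmulA hR).
Qed.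

Lemma smash_src_r v r r' : (v *t r) ** (1a *t r') = v *t (r *r r') :> W.
Proof.
rewrite smash_tens (cop_one hV (smash_bal1 _ _ _)) mulr1.
by rewrite (rm_one (yd_mod (ym_YD hR))).
Qed.

(** V acts on 1R through the counit, so w2 contributes s(cou w2), which crosses back over B and is
    absorbed by w1 s(cou w2) = w. *)
Lemma smash_one_l v w r : (v *t 1R) ** (w *t r) = (v *a w) *t r :> W.
Proof.
rewrite smash_tens -[in RHS](rb_cour hV w).
rewrite (lin_tlift (g := fun z => (v *a z) *t r : W)); last by lin.
apply: eq_tlift => w1 w2; rewrite /btri_r mulA (tens_src hR).
by rewrite (one_act hR) (rmul_mid hR) (rmul1 hR).
Qed.

Lemma smash_mul1 (x : W) : (1a *t 1R) ** x = x.
Proof.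
move: x; apply tensor_ext; [by lin | by lin | move=> v r].
by rewrite smash_one_l mul1.
Qed.

Lemma smash_mulr1 (x : W) : x ** (1a *t 1R) = x.
Proof.
move: x; apply tensor_ext; [by lin | by lin | move=> v r].
by rewrite smash_src_r (rmulr1 hR).
Qed.

(** * The target map of V # R *)

Lemma smash_tgt_one b v r : (v *t r) ** (t b *t 1R) = (v *a t b) *t r :> W.
Proof.
rewrite smash_tens (cop_tgt hV) tlift_tens; last exact: smash_bal1.
by rewrite (rm_one (yd_mod (ym_YD hR))) (rmulr1 hR).
Qed.

(** The map b |-> 1R t(b) is the unit B -> R. Along it the target of V # R extends t, just as the
    source extends s. *)
Lemma coact_one_tgt b : coact (1R <*| t b) = t b *t 1R :> W.
Proof.
rewrite -[LHS]tliftE (coact_tgt hR (balanced_tens _ _)) (ym_coact_one hR).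
rewrite tlift_tens ?mul1 //; split=> *; [by lin | by lin | ].
by rewrite (lactE hR) -(tens_src hR) /btri_r -!mulA (rb_src_tgt hV).
Qed.

Lemma cou_src v b : cou (v *a s b) = cou v *a b.
Proof.
have := rb_cou_bimod hV 1a b v.
by rewrite /btri_l (rb_tgt_one hV) mulr1 (alg_mul1r (rb_base hV)).
Qed.

(* t(b), not s(b): the Takeuchi-type property moves s(b) on m^(-1) to the right
   action on m^(0), whereas the coaction of the product m b has t(b) on m^(-1). *)
Lemma coact_src (Z : lmodType k) (F : V -> R -> Z) m b : balR F ->
  tlift (coact (m <*| s b)) F = \sw_(x, n <- coact m) F (t b *a x) n.
Proof.
move=> hF; have [F1 F2 F3] := hF.
have {1}-> : m <*| s b = coact_r m b by rewrite (yd_bimod_r (ym_YD hR)).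
rewrite /coact_r (lin_tlift _ _ (lc_coact_lin (yd_comod (ym_YD hR)))) tlift_tlift //.
(* Left B-linearity of the coaction writes the counit value as a factor t(cou(t(b) x)) to the right
   of y. By coassociativity x and y come from one coproduct, and the left counit law collapses them
   to t(b) x. *)
transitivity (\sw_(x, n <- coact m) \sw_(y, n' <- coact n)
    F (y *a t (cou (t b *a x))) n').
  by apply: eq_tlift => x n; rewrite (lactE hR) (coact_tgt hR hF).
rewrite -(coact_coassoc (F := fun x y n => F (y *a t (cou (t b *a x))) n) hR); last first.
  split=> [c n | a n | a c | a d c n | a d c n].
  - by apply: (lin_comp (F1 n)); lin.
  - by apply: (lin_comp (F1 n)); lin.
  - exact: F2.
  - by rewrite mulA cou_src (rb_tgt_mul hV) mulA.
  - by rewrite -mulA (rb_src_tgt hV) mulA F3.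
apply: eq_tlift => x n; rewrite -[in RHS](rb_coul hV (t b *a x)) /btri_l.
rewrite (lin_tlift _ _ (F1 n)) (cop_mull_tgt hV) //.
split=> [c | a | a d c].
- by apply: (lin_comp (F1 n)); lin.
- by apply: (lin_comp (F1 n)); lin.
by rewrite /btri_r /btri_l cou_src (rb_tgt_mul hV) mulA.
Qed.

Hypothesis hbc : is_braided_commutative R.

(** The product yields (r b) n with b from the coproduct of m^(-1). Coassociativity makes b the
    coaction component of m^(0), and braided commutativity then reads the factor as m^(0) r. *)
Lemma smash_tgt_r v r m :
  (v *t r) ** coact m = \sw_(x, n <- coact m) ((v *a x) *t (n *r r)) :> W.
Proof.
rewrite -[coact m in LHS](tliftE (coact m : W)) (lin_tlift _ _ (smash_linr _)).
transitivity (\sw_(x, n <- coact m) \sw_(a, b <- cop x)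
    ((v *a a) *t ((r <*| b) *r n) : W)).
  by apply: eq_tlift => x n; rewrite smash_tens.
rewrite (coact_coassoc (F := fun a b n => (v *a a) *t ((r <*| b) *r n) : W) hR).
  apply: eq_tlift => x n; rewrite hbc.
  by rewrite (lin_tlift (g := fun z => (v *a x) *t z : W)) //; lin.
split=> *; [by lin | by lin | by lin | |].
  by rewrite mulA (tens_src hR) (rmul_tgt hV hR) (actA hR).
by rewrite -(actA hR) (rmul_mid hR) (lactE hR).
Qed.

Lemma smash_coact_mul r r' : coact (r *r r') = coact r' ** coact r :> W.
Proof.
rewrite (ym_coact_mul hR) -[coact r' in RHS](tliftE (coact r' : W)).
rewrite (lin_tlift _ _ (smash_linl _)); apply: eq_tlift => x n.
by rewrite smash_tgt_r.
Qed.

(** Sources multiply the R-component on the right and, by [smash_tgt_r], targets multiply it on the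
    left. *)
Lemma smash_src_tgt r m : (1a *t r) ** coact m = coact m ** (1a *t r) :> W.
Proof.
rewrite -[coact m in RHS](tliftE (coact m : W)).
rewrite (lin_tlift _ _ (smash_linl _)) smash_tgt_r; apply: eq_tlift => x n.
by rewrite smash_src_r mul1.
Qed.

(** * The tensor square over R and the coproduct *)

Lemma smash_tens_mid w r w' : (w ** (1a *t r)) *t w' = w *t (w' ** coact r) :> W2.
Proof. exact: (tens_mid wr wl). Qed.

(** Normal form in the codomain: the R-component of the left leg is the source of r and crosses over
    as a target. *)
Lemma smash_tens_mid1 v r w' : (v *t r) *t w' = (v *t 1R) *t (w' ** coact r) :> W2.
Proof. by rewrite -smash_tens_mid smash_src_r (rmul1 hR). Qed.

(** Balancing over R includes balancing over B: s(b) (x) 1R is the source of 1R t(b), whose target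
    is t(b) (x) 1R. *)
Lemma smash_tens_mid_base v b v' r :
  ((v *a s b) *t 1R) *t (v' *t r) = (v *t 1R) *t ((v' *a t b) *t r) :> W2.
Proof.
by rewrite (tens_src hR) smash_tens_mid1 coact_one_tgt smash_tgt_one.
Qed.

Lemma smash_cop_bal1 r : bal2 (fun v1 v2 => (v1 *t 1R) *t (v2 *t r) : W2).
Proof. by split=> *; [lin | lin | apply: smash_tens_mid_base]. Qed.

Lemma smash_cop_bal2 :
  balR (fun v r => \sw_(v1, v2 <- cop v) ((v1 *t 1R) *t (v2 *t r)) : W2).
Proof.
split=> [r | v | v b r]; [lin; exact: smash_cop_bal1 | by lin | ].
rewrite /btri_r (cop_mulr_src hV (smash_cop_bal1 _)); apply: eq_tlift => v1 v2.
by rewrite (tens_src hR) (lactE hR).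
Qed.

Lemma smash_cop_lin : linear scop.
Proof. exact: tlift_lin (@lin_id _ _) smash_cop_bal2. Qed.

Lemma smash_cop_tens v r :
  scop (v *t r) = \sw_(v1, v2 <- cop v) ((v1 *t 1R) *t (v2 *t r)) :> W2.
Proof. exact: (tlift_tens _ _ smash_cop_bal2). Qed.

Lemma smash_bimod_bal b b' :
  balanced wr wl (fun w1 w2 => (w1 ** coact b) *t (w2 ** (1a *t b')) : W2).
Proof.
split=> [w | w | w r w']; [by lin | by lin | ].
rewrite -!smash_assoc smash_src_tgt.
rewrite smash_assoc smash_tens_mid.
by rewrite -smash_assoc smash_src_tgt.
Qed.

(** On the left the coproduct hits b^(-1). On the right b^(0) stays in the first leg and, crossing
    to the second as a target, is coacted on again. Coassociativity of the coaction equates the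
    two. *)
Lemma smash_cop_bimod b b' x :
  scop (x ** coact b ** (1a *t b')) =
  \sw_(w1, w2 <- scop x) ((w1 ** coact b) *t (w2 ** (1a *t b'))) :> W2.
Proof.
have scopl := smash_cop_lin.
move: x; apply tensor_ext.
- by apply: (lin_comp scopl); lin.
- exact: (tlift_lin scopl (smash_bimod_bal b b')).
move=> v r.
rewrite smash_tgt_r (lin_tlift _ _ (smash_linl _)).
rewrite (lin_tlift _ _ scopl) smash_cop_tens (tlift_tlift _ _ (smash_bimod_bal b b')).
transitivity (\sw_(v1, v2 <- cop v) \sw_(x, n <- coact b) \sw_(x1, x2 <- cop x)
   (((v1 *a x1) *t 1R) *t ((v2 *a x2) *t (n *r (r *r b'))) : W2)).
  rewrite tlift_exch; apply: eq_tlift => x n.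
  rewrite smash_src_r smash_cop_tens (cop_mul hV (smash_cop_bal1 _)).
  by rewrite (rmulA hR).
apply: eq_tlift => v1 v2; rewrite tlift_tens; last exact: smash_bimod_bal.
rewrite (coact_coassoc (F := fun x1 x2 n =>
   ((v1 *a x1) *t 1R) *t ((v2 *a x2) *t (n *r (r *r b'))) : W2) hR); last first.
  split=> *; [by lin | by lin | by lin | |].
    by rewrite !mulA smash_tens_mid_base.
  by rewrite mulA (tens_src hR) (rmul_tgt hV hR) (lactE hR).
rewrite smash_tgt_r smash_src_r.
rewrite (lin_tlift (g := fun z => z *t (v2 *t (r *r b')) : W2)); last by lin.
apply: eq_tlift => x n; rewrite (rmulr1 hR) smash_tens_mid1 smash_tgt_r.
by rewrite (lin_tlift (g := fun z => (v1 *a x) *t 1R *t z : W2)) //; lin.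
Qed.

(** * The counit *)

Lemma smash_cou_bal : balR (fun v r => cou v |*> r).
Proof.
split=> [r | v | v b r]; [by lin | by lin | ].
by rewrite /btri_r cou_src (lc_mul (yd_comod (ym_YD hR))).
Qed.

Lemma smash_cou_lin : linear scou.
Proof. exact: tlift_lin (@lin_id _ _) smash_cou_bal. Qed.

Lemma smash_cou_tens v r : scou (v *t r) = cou v |*> r.
Proof. exact: (tlift_tens _ _ smash_cou_bal). Qed.

Lemma smash_cou_bimod b b' x :
  scou (x ** coact b ** (1a *t b')) = b *r scou x *r b'.
Proof.
have scoul := smash_cou_lin.
move: x; apply tensor_ext.
- by apply: (lin_comp scoul); lin.
- by apply: (lin_comp (g := fun z => b *r z *r b')) scoul; lin.
move=> v r.
rewrite smash_tgt_r (lin_tlift _ _ (smash_linl _)).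
rewrite (lin_tlift _ _ scoul) smash_cou_tens.
transitivity (\sw_(x, n <- coact b) ((cou (v *a x) |*> n) *r (r *r b'))).
  apply: eq_tlift => x n; rewrite smash_src_r smash_cou_tens !(lactE hR).
  by rewrite -(rmulA hR) (rmul_tgt hV hR).
rewrite -(lin_tlift (g := fun z => z *r (r *r b'))); last by lin.
by rewrite (coact_cou hV hR) (rmulA hR) (rmul_mid hR) (lactE hR).
Qed.

Lemma smash_cop_src x r :
  scop (x ** (1a *t r)) = \sw_(w1, w2 <- scop x) (w1 *t (w2 ** (1a *t r))) :> W2.
Proof.
have := smash_cop_bimod 1R r x; rewrite (ym_coact_one hR) smash_mulr1 => ->.
by apply: eq_tlift => w1 w2; rewrite smash_mulr1.
Qed.

Lemma smash_cop_tgt x r :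
  scop (x ** coact r) = \sw_(w1, w2 <- scop x) ((w1 ** coact r) *t w2) :> W2.
Proof.
have := smash_cop_bimod r 1R x; rewrite smash_mulr1 => ->.
by apply: eq_tlift => w1 w2; rewrite smash_mulr1.
Qed.

Lemma smash_cou_src x r : scou (x ** (1a *t r)) = scou x *r r.
Proof.
have := smash_cou_bimod 1R r x.
by rewrite (ym_coact_one hR) smash_mulr1 (rmul1 hR).
Qed.

Lemma smash_cou_tgt x r : scou (x ** coact r) = r *r scou x.
Proof.
have := smash_cou_bimod r 1R x.
by rewrite smash_mulr1 (rmulr1 hR).
Qed.

Lemma smash_coul (x : W) : \sw_(w1, w2 <- scop x) (w2 ** coact (scou w1)) = x.
Proof.
have scoul := smash_cou_lin.
have bal : balanced wr wl (fun w1 w2 => w2 ** coact (scou w1)).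
  split=> [w | w | w r w']; [ | by lin | ].
    by apply: lin_smash_r; apply: (lin_coact hR); exact: scoul.
  (* The target reverses products, so the factor r lands next to w'. *)
  by rewrite smash_cou_src smash_coact_mul smash_assoc.
move: x; apply tensor_ext; [exact: (tlift_lin smash_cop_lin bal) | by lin | ].
move=> v r; rewrite smash_cop_tens (tlift_tlift _ _ bal).
rewrite -[in RHS](rb_coul hV v) (lin_tlift (g := fun z => z *t r : W)); last by lin.
apply: eq_tlift => v1 v2; rewrite tlift_tens // smash_cou_tens (lactE hR).
by rewrite coact_one_tgt smash_tgt_one.
Qed.

Lemma smash_cour (x : W) : \sw_(w1, w2 <- scop x) (w1 ** (1a *t scou w2)) = x.
Proof.
have scoul := smash_cou_lin.
have bal : balanced wr wl (fun w1 w2 => w1 ** (1a *t scou w2)).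
  split=> [w | w | w r w']; [ by lin | | ].
    by apply: lin_smash_r; apply: lin_tens_r; exact: scoul.
  by rewrite smash_cou_tgt -smash_assoc smash_src_r.
move: x; apply tensor_ext; [exact: (tlift_lin smash_cop_lin bal) | by lin | ].
move=> v r; rewrite smash_cop_tens (tlift_tlift _ _ bal).
rewrite -[in RHS](rb_cour hV v) (lin_tlift (g := fun z => z *t r : W)); last by lin.
apply: eq_tlift => v1 v2; rewrite tlift_tens // smash_cou_tens (lactE hR).
by rewrite smash_src_r (rmul1 hR) /btri_r (tens_src hR).
Qed.

(** * Coassociativity *)

Let W3 := tensor (fun (x : W2) r => \sw_(w, w' <- x) (w *t (w' ** (1a *t r))) : W2) wl.

Lemma smash_tens3_mid_bal r :
  balanced wr wl (fun w w' => w *t (w' ** (1a *t r)) : W2).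
Proof.
split=> [w | w | w r' w']; [by lin | by lin | ].
rewrite smash_tens_mid -!smash_assoc.
by rewrite smash_src_tgt.
Qed.

Lemma smash_tens3_mid w w' r w'' :
  (w *t (w' ** (1a *t r)) : W2) *t w'' = (w *t w' : W2) *t (w'' ** coact r) :> W3.
Proof.
rewrite -(tens_mid _ wl) tlift_tens //; exact: smash_tens3_mid_bal.
Qed.

Lemma smash_coassoc_bal1 : balanced wr wl (fun w1 w2 => scop w1 *t w2 : W3).
Proof.
have scopl := smash_cop_lin.
split=> [w | w | w r w']; [ | by lin | ].
  by apply: lin_tens_l; exact: scopl.
by rewrite smash_cop_src (tens_mid _ wl).
Qed.

Lemma smash_coassoc_bal2 w1 : balanced wr wl (fun a b => (w1 *t a : W2) *t b : W3).
Proof. by split=> [w | w | w r w']; [lin | lin | exact: smash_tens3_mid]. Qed.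

Lemma smash_coassoc_bal3 :
  balanced wr wl (fun w1 w2 => \sw_(a, b <- scop w2) ((w1 *t a : W2) *t b) : W3).
Proof.
have scopl := smash_cop_lin.
split=> [w | w | w r w']; [by lin | | ].
  exact: (tlift_lin scopl (smash_coassoc_bal2 w)).
rewrite smash_cop_tgt (tlift_tlift _ _ (smash_coassoc_bal2 w)).
apply: eq_tlift => a b; rewrite tlift_tens; last exact: smash_coassoc_bal2.
by rewrite smash_tens_mid.
Qed.

Lemma smash_coassoc x :
  \sw_(w1, w2 <- scop x) (scop w1 *t w2) =
  \sw_(w1, w2 <- scop x) \sw_(a, b <- scop w2) ((w1 *t a : W2) *t b) :> W3.
Proof.
have scopl := smash_cop_lin.
move: x; apply tensor_ext.
- exact: tlift_lin scopl smash_coassoc_bal1.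
- exact: tlift_lin scopl smash_coassoc_bal3.
move=> v r; rewrite smash_cop_tens.
rewrite (tlift_tlift _ _ smash_coassoc_bal1) (tlift_tlift _ _ smash_coassoc_bal3).
transitivity (\sw_(v1, v2 <- cop v) \sw_(a, b <- cop v1)
   (((a *t 1R) *t (b *t 1R) : W2) *t (v2 *t r) : W3)).
  apply: eq_tlift => v1 v2; rewrite tlift_tens; last exact: smash_coassoc_bal1.
  rewrite smash_cop_tens (lin_tlift (g := fun z : W2 => z *t (v2 *t r) : W3)) //.
  by lin.
rewrite (cop_coassoc (F := fun a b c =>
   ((a *t 1R) *t (b *t 1R) : W2) *t (c *t r) : W3) hV); last first.
  split=> *; [by lin | by lin | by lin | |].
    by rewrite smash_tens_mid_base.
  (* An s(b) in the middle leg is the source of 1R t(b); it crosses to the third leg as the target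
     t(b) (x) 1R. *)
  rewrite (tens_src hR) -(rmul1 hR (1R <*| _)) -smash_src_r.
  by rewrite smash_tens3_mid coact_one_tgt smash_tgt_one.
apply: eq_tlift => v1 v2; rewrite tlift_tens; last exact: smash_coassoc_bal3.
rewrite smash_cop_tens (tlift_tlift _ _ (smash_coassoc_bal2 _)).
apply: eq_tlift => a b; rewrite tlift_tens //; exact: smash_coassoc_bal2.
Qed.

(** * The Takeuchi condition and multiplicativity of the coproduct *)

Lemma smash_mul_bal x1 x2 : balanced wr wl (fun w w' => (x1 ** w) *t (x2 ** w') : W2).
Proof.
split=> [w | w | w r w']; [by lin | by lin | ].
by rewrite !smash_assoc smash_tens_mid.
Qed.

(** Moving m v^(2) from the left leg to the right as a target gives v^(1) (x) v^(3) (m v^(2))^(-1) #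
    (m v^(2))^(0) r. The Yetter-Drinfeld condition at m rewrites the right leg as the target of m
    times v^(2) # r. *)
Lemma smash_takeuchi m x :
  \sw_(w1, w2 <- scop x) (((1a *t m) ** w1) *t w2) =
  \sw_(w1, w2 <- scop x) (w1 *t (coact m ** w2)) :> W2.
Proof.
have scopl := smash_cop_lin.
have bal1 : balanced wr wl (fun w w' => ((1a *t m) ** w) *t w' : W2).
  split=> [w | w | w r w']; [by lin | by lin | ].
  by rewrite !smash_assoc smash_tens_mid.
have bal2 : balanced wr wl (fun w w' => w *t (coact m ** w') : W2).
  split=> [w | w | w r w']; [by lin | by lin | ].
  by rewrite smash_tens_mid smash_assoc.
move: x; apply tensor_ext; try exact: tlift_lin scopl _.
move=> v r; rewrite smash_cop_tens.
rewrite (tlift_tlift _ _ bal1) (tlift_tlift _ _ bal2).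
have balF v1 : balR (fun x n => (v1 *t 1R) *t (x *t (n *r r)) : W2).
  split=> [w | w | w b w']; [by lin | by lin | ].
  by rewrite (tens_src hR) (rmul_tgt hV hR) (lactE hR).
have balG v1 c : balR (fun x n => (v1 *t 1R) *t ((c *a x) *t (n *r r)) : W2).
  split=> [w | w | w b w']; [by lin | by lin | ].
  by rewrite /btri_r mulA (tens_src hR) (rmul_tgt hV hR) (lactE hR).
transitivity (\sw_(v1, v2 <- cop v) \sw_(a, b <- cop v1)
   \sw_(x, n <- coact (m <*| b)) ((a *t 1R) *t ((v2 *a x) *t (n *r r)) : W2)).
  apply: eq_tlift => v1 v2; rewrite tlift_tens // smash_tens.
  rewrite (lin_tlift (g := fun z => z *t (v2 *t r) : W2)); last by lin.
  apply: eq_tlift => a b; rewrite mul1 (rmulr1 hR) smash_tens_mid1 //.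
  rewrite smash_tgt_r.
  by rewrite (lin_tlift (g := fun z => a *t 1R *t z : W2)) //; lin.
rewrite (cop_coassoc (F := fun a b c => \sw_(x, n <- coact (m <*| b))
   ((a *t 1R) *t ((c *a x) *t (n *r r)) : W2)) hV); last first.
  split=> [b c | a c | a b | a d b c | a b d c]; [by lin | | by lin | |].
  - by lin; exact: balG.
  - rewrite -(actA hR) (coact_tgt hR (balG _ _)); apply: eq_tlift => x n.
    by rewrite smash_tens_mid_base mulA.
  (* The s(d) acting on m appears as t(d) on the left of the coaction component, hence on the right
     of c. *)
  - rewrite -(actA hR) (coact_src _ _ (balG _ _)); apply: eq_tlift => x n.
    by rewrite /btri_l mulA.
apply: eq_tlift => v1 v2; rewrite tlift_tens //.
rewrite -(coact_act hR (balF v1)).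
rewrite -[coact m in RHS](tliftE (coact m : W)).
rewrite (lin_tlift _ _ (smash_linl _)).
rewrite (lin_tlift (g := fun z => v1 *t 1R *t z : W2)); last by lin.
apply: eq_tlift => x n; rewrite smash_tens.
by rewrite (lin_tlift (g := fun z => v1 *t 1R *t z : W2)) //; lin.
Qed.

(** The counterpart over R of [balanced_mulr_cop], with [smash_takeuchi] in place of the Takeuchi
    condition of V. *)
Lemma smash_cop_mul_bal y :
  balanced wr wl (fun x1 x2 => \sw_(y1, y2 <- scop y) ((x1 ** y1) *t (x2 ** y2)) : W2).
Proof.
split=> [w | w | w r w']; [by lin | by lin | ].
transitivity (\sw_(y1, y2 <- scop y)
    tlift (((1a *t r) ** y1) *t y2 : W2) (fun a b => (w ** a) *t (w' ** b) : W2)).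
  apply: eq_tlift => y1 y2; rewrite tlift_tens; last exact: smash_mul_bal.
  by rewrite smash_assoc.
rewrite -(tlift_tlift _ _ (smash_mul_bal w w')) smash_takeuchi.
rewrite (tlift_tlift _ _ (smash_mul_bal w w')); apply: eq_tlift => y1 y2.
by rewrite tlift_tens ?smash_assoc //; apply: smash_mul_bal.
Qed.

Lemma smash_cop_mul x y :
  scop (x ** y) = \sw_(x1, x2 <- scop x) \sw_(y1, y2 <- scop y)
    ((x1 ** y1) *t (x2 ** y2)) :> W2.
Proof.
have scopl := smash_cop_lin.
move: x; apply tensor_ext.
- by apply: (lin_comp scopl); lin.
- exact: (tlift_lin scopl (smash_cop_mul_bal y)).
move=> v r; move: y; apply tensor_ext.
- by apply: (lin_comp scopl); lin.
- apply: tlift_lin_param => w w'; exact: (tlift_lin scopl (smash_mul_bal w w')).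
move=> w r'.
rewrite (smash_cop_tens v) (tlift_tlift _ _ (smash_cop_mul_bal _)).
rewrite smash_tens (lin_tlift _ _ scopl).
transitivity (\sw_(v1, v2 <- cop v) \sw_(w1, w2 <- cop w) \sw_(a, b <- cop w1)
   (((v1 *a a) *t 1R) *t ((v2 *a b) *t ((r <*| w2) *r r')) : W2)).
  rewrite tlift_exch; apply: eq_tlift => w1 w2; rewrite smash_cop_tens.
  by rewrite (cop_mul hV (smash_cop_bal1 _)).
apply: eq_tlift => v1 v2; rewrite tlift_tens; last exact: smash_cop_mul_bal.
rewrite (cop_coassoc (F := fun a b c =>
   ((v1 *a a) *t 1R) *t ((v2 *a b) *t ((r <*| c) *r r')) : W2) hV); last first.
  split=> *; [by lin | by lin | by lin | |].
    by rewrite !mulA smash_tens_mid_base.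
  by rewrite mulA (tens_src hR) (rmul_tgt hV hR) (actA hR).
rewrite (smash_cop_tens w) (tlift_tlift _ _ (smash_mul_bal _ _)).
apply: eq_tlift => w1 w2; rewrite tlift_tens; last exact: smash_mul_bal.
rewrite smash_one_l smash_tens.
by rewrite (lin_tlift (g := fun z => (v1 *a w1) *t 1R *t z : W2)) //; lin.
Qed.

Lemma smash_cop_one : scop (1a *t 1R) = (1a *t 1R) *t (1a *t 1R) :> W2.
Proof.
by rewrite smash_cop_tens (cop_one hV (smash_cop_bal1 _)).
Qed.

(** The right side sees the first factor only through its counit, which yields both multiplicative
    laws below. Replacing v by s(cou v), the Takeuchi condition moves it to t(cou v) w2, and the
    left counit law recovers w. *)
Lemma smash_cou_mul_tens v r w r' :
  scou ((v *t r) ** (w *t r')) = ((cou v |*> r) <*| w) *r r'.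
Proof.
have scoul := smash_cou_lin.
rewrite smash_tens (lin_tlift _ _ scoul).
have bal : bal2 (fun a b => cou a |*> ((r <*| b) *r r')).
  split=> [b | a | a b c]; [by lin | by lin | ].
  rewrite /btri_r /btri_l cou_src (lc_mul (yd_comod (ym_YD hR))).
  by rewrite !(lactE hR) (rmul_tgt hV hR) !(actA hR).
transitivity (\sw_(w1, w2 <- cop w)
    (cou (s (cou v) *a w1) |*> ((r <*| w2) *r r'))).
  by apply: eq_tlift => w1 w2; rewrite smash_cou_tens (rb_cou_mul_src hV).
rewrite (cop_takeuchi hV bal) -[in RHS](rb_coul hV w).
rewrite (lin_tlift (g := fun z => (cou v |*> r) <*| z *r r')); last by lin.
apply: eq_tlift => w1 w2; rewrite /btri_l !(lactE hR) (rmul_tgt hV hR).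
by rewrite !(actA hR) mulA.
Qed.

Lemma smash_cou_mul_src x y : scou (x ** y) = scou ((1a *t scou x) ** y).
Proof.
have scoul := smash_cou_lin.
move: x; apply tensor_ext.
- by apply: (lin_comp scoul); lin.
- apply: (lin_comp (g := fun z => scou ((1a *t z) ** y)) _ scoul).
  by apply: (lin_comp scoul); lin.
move=> v r; move: y; apply tensor_ext.
- by apply: (lin_comp scoul); lin.
- by apply: (lin_comp scoul); lin.
move=> w r'; rewrite !smash_cou_mul_tens (rb_cou_one hV).
by rewrite smash_cou_tens (lc_one (yd_comod (ym_YD hR))).
Qed.

Lemma smash_cou_mul_tgt x y : scou (x ** y) = scou (coact (scou x) ** y).
Proof.
have scoul := smash_cou_lin.
move: x; apply tensor_ext.
- by apply: (lin_comp scoul); lin.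
- apply: (lin_comp (g := fun z => scou (coact z ** y)) _ scoul).
  by apply: (lin_comp scoul); lin.
move=> v r; move: y; apply tensor_ext.
- by apply: (lin_comp scoul); lin.
- by apply: (lin_comp scoul); lin.
move=> w r'; rewrite smash_cou_mul_tens smash_cou_tens.
rewrite -[coact _](tliftE (coact _ : W)) (lin_tlift _ _ (smash_linl _)).
rewrite (lin_tlift _ _ scoul).
(* Counitality of the coaction says that the counit of V # R undoes the target. *)
rewrite -[in LHS](lc_counit (yd_comod (ym_YD hR)) (cou v |*> r)).
rewrite (lin_tlift (g := fun z => (z <*| w) *r r')); last by lin.
by apply: eq_tlift => x n; rewrite smash_cou_mul_tens.
Qed.

(** * Assembly of the bialgebroid axioms *)

Lemma smash_is_algebra : is_algebra (smash_alg R).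
Proof.
split.
- exact: smash_linl.
- exact: smash_linr.
- exact: smash_assoc.
- exact: smash_mul1.
- exact: smash_mulr1.
Qed.

Lemma smash_is_right_bialgebroid : is_right_bialgebroid (smash R).
Proof.
split.
- exact: ym_algebra hR.
- exact: smash_is_algebra.
- exact: (lin_tensr _ _ 1a).
- move=> r r'; exact: esym (smash_src_r _ _ _).
- by [].
- exact: lc_coact_lin (yd_comod (ym_YD hR)).
- exact: smash_coact_mul.
- exact: ym_coact_one hR.
- exact: smash_src_tgt.
- exact: smash_cop_lin.
- exact: smash_cop_bimod.
- exact: smash_cou_lin.
- exact: smash_cou_bimod.
- exact: smash_coassoc.
- exact: smash_coul.
- exact: smash_cour.
- exact: smash_takeuchi.
- exact: smash_cop_one.
- exact: smash_cop_mul.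
- have := smash_cou_tens 1a 1R; rewrite (rb_cou_one hV) => h.
  exact: etrans h (lc_one (yd_comod (ym_YD hR)) _).
- exact: smash_cou_mul_src.
- exact: smash_cou_mul_tgt.
Qed.

(** * The Hopf map of V # R *)

Local Notation T2 := (tensor (@btri_r k B V) (@btri_l k B V)).
Local Notation D := (tensor (@btri_r k B V) (@wtri_l k B V)).
Local Notation balD := (balanced (@btri_r k B V) (@wtri_l k B V)).
Local Notation dl := (fun (r : R) (w : W) => (1a *t r : W) ** w).
Local Notation DW := (tensor wr dl).
Local Notation betaW := (@beta_l k (ym_alg R) (smash R) : DW -> W2).

Let hW := smash_is_right_bialgebroid.

Lemma smash_beta_tens w' w :
  betaW (w' *t w) = \sw_(w1, w2 <- scop w) (w1 *t (w' ** w2)) :> W2.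
Proof. exact: (beta_tens hW). Qed.

Lemma smash_src_base b v r : (1a *t (1R <*| t b)) ** (v *t r) = (s b *a v) *t r :> W.
Proof. by rewrite -(tens_src hR) mul1 smash_one_l. Qed.

Lemma smash_dom_mid w r w' : (w ** (1a *t r)) *t w' = w *t ((1a *t r : W) ** w') :> DW.
Proof. exact: (tens_mid wr dl). Qed.

Lemma smash_dom_bal q : balD (fun a c => (a *t 1R) *t (c *t q) : DW).
Proof.
split=> [c | a | a b c]; [by lin | by lin | ].
rewrite /btri_r (tens_src hR) -[X in a *t X](rmul1 hR) -smash_src_r.
by rewrite smash_dom_mid smash_src_base.
Qed.

(** [smash_dom] and [smash_cod] are the comparison maps from V (x) V (x) R to the domain and the
    codomain of the Hopf map. The component q in R is kept as a parameter, so that no triple tensor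
    product has to be formed. *)
Definition smash_dom q (x : D) : DW := \sw_(a, c <- x) ((a *t 1R) *t (c *t q)).

Definition smash_cod q (x : T2) : W2 := \sw_(a, c <- x) ((a *t 1R) *t (c *t q)).

Lemma smash_dom_lin q : linear (smash_dom q).
Proof. exact: tlift_lin (@lin_id _ _) (smash_dom_bal q). Qed.

Lemma smash_cod_lin q : linear (smash_cod q).
Proof. exact: tlift_lin (@lin_id _ _) (smash_cop_bal1 q). Qed.

Lemma smash_dom_lin_r x : linear (fun q => smash_dom q x).
Proof. by rewrite /smash_dom; lin. Qed.

Lemma smash_dom_tens q a c : smash_dom q (a *t c) = (a *t 1R) *t (c *t q).
Proof. exact: (tlift_tens _ _ (smash_dom_bal q)). Qed.

Lemma smash_cod_tens q a c : smash_cod q (a *t c) = (a *t 1R) *t (c *t q).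
Proof. exact: (tlift_tens _ _ (smash_cop_bal1 q)). Qed.

Lemma smash_dom_btri_r q x b :
  smash_dom q (dom_btri_r x b) = smash_dom (b |*> q) x.
Proof.
rewrite {1}/smash_dom (tlift_tlift _ _ (smash_dom_bal q)); apply: eq_tlift => a c.
by rewrite (tlift_tens _ _ (smash_dom_bal q)) (tens_src hR) (lactE hR).
Qed.

(** The Hopf map is [beta_l] (x) R under the two comparison maps, because the coproduct of V # R
    carries q along unchanged in its last leg. *)
Lemma smash_beta_dom q x : betaW (smash_dom q x) = smash_cod q (beta_l x).
Proof.
move: x; apply tensor_ext.
- exact: lin_comp (beta_lin hW) (smash_dom_lin q).
- exact: lin_comp (smash_cod_lin q) (beta_lin hV).
move=> a c; rewrite smash_dom_tens smash_beta_tens (beta_tens hV).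
rewrite smash_cop_tens (tlift_tlift _ _ (beta_bal_in hW (a *t 1R))).
rewrite (lin_tlift _ _ (smash_cod_lin q)); apply: eq_tlift => v1 v2.
by rewrite (tlift_tens _ _ (beta_bal_in hW (a *t 1R))) smash_cod_tens -smash_one_l.
Qed.

Section Inverse.
Variable gamma : T2 -> D.
Hypotheses (gammaK : cancel (@beta_l k B V) gamma).
Hypotheses (betaK : cancel gamma (@beta_l k B V)).

Lemma gamma_lin : linear gamma.
Proof.
by move=> c x y; apply: (can_inj gammaK); rewrite (beta_lin hV) !betaK.
Qed.

Lemma lin_gamma (Y : lmodType k) (f : Y -> T2) : linear f -> linear (fun y => gamma (f y)).
Proof. exact: lin_comp gamma_lin. Qed.

Lemma gamma_btri_r v u b : gamma (v *t (u *a s b)) = dom_btri_r (gamma (v *t u)) b.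
Proof.
apply: (can_inj gammaK); rewrite (beta_dom_btri_r hV) !betaK.
by rewrite /copTensor_btri_r (tlift_tens _ _ (copTensor_btri_r_bal hV b)).
Qed.

(** The inverse Hopf map at (v # 1) (x) w, before arbitrary left legs are allowed. *)
Definition smash_gamma_base (v : V) (w : W) : DW :=
  \sw_(u, q <- w) smash_dom q (gamma (v *t u)).

Lemma smash_gamma_base_bal v : balR (fun u q => smash_dom q (gamma (v *t u))).
Proof.
split=> [q | u | u b q].
- by apply: (lin_comp (smash_dom_lin q)); apply: lin_gamma; lin.
- exact: smash_dom_lin_r.
by rewrite /btri_r gamma_btri_r smash_dom_btri_r.
Qed.

Lemma smash_gamma_base_tens v u q :
  smash_gamma_base v (u *t q) = smash_dom q (gamma (v *t u)).
Proof. exact: (tlift_tens _ _ (smash_gamma_base_bal v)). Qed.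

Lemma smash_gamma_base_lin_r v : linear (smash_gamma_base v).
Proof. exact: tlift_lin (@lin_id _ _) (smash_gamma_base_bal v). Qed.

Lemma smash_gamma_base_lin_l w : linear (fun v => smash_gamma_base v w).
Proof.
apply: tlift_lin_param => u q.
by apply: (lin_comp (smash_dom_lin q)); apply: lin_gamma; lin.
Qed.

Lemma smash_gamma_base_mid v b w :
  smash_gamma_base (v *a s b) w = smash_gamma_base v (w ** coact (1R <*| t b)).
Proof.
have hl := smash_gamma_base_lin_r.
move: w; apply tensor_ext; [exact: hl | by apply: (lin_comp (hl v)); lin | ].
move=> u q; rewrite coact_one_tgt smash_tgt_one.
by rewrite !smash_gamma_base_tens (tens_mid (@btri_r k B V)).
Qed.

Lemma smash_gamma_bal_in w :
  balR (fun v r => smash_gamma_base v (w ** coact r)).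
Proof.
split=> [r | v | v b r].
- exact: smash_gamma_base_lin_l.
- by apply: (lin_comp (smash_gamma_base_lin_r v)); lin.
rewrite /btri_r smash_gamma_base_mid -smash_assoc (lactE hR).
by rewrite -smash_coact_mul -(rmul_tgt hV hR) (rmul1 hR).
Qed.

(** Passing a source of r' across turns r into r r', whose target is tgt(r') tgt(r): the same as
    first multiplying w by tgt(r'). *)
Lemma smash_gamma_bal :
  balanced wr wl (fun w' w => \sw_(v, r <- w') smash_gamma_base v (w ** coact r)).
Proof.
have bal_in := smash_gamma_bal_in.
split=> [w | w' | w' r w].
- exact: tlift_lin (@lin_id _ _) (bal_in w).
- apply: tlift_lin_param => v r.
  by apply: (lin_comp (smash_gamma_base_lin_r v)); lin.
move: w'; apply tensor_ext.
- by apply: (tlift_lin _ (bal_in w)); lin.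
- exact: tlift_lin (@lin_id _ _) (bal_in _).
move=> v q; rewrite smash_src_r.
rewrite (tlift_tens _ _ (bal_in _)) (tlift_tens _ _ (bal_in _)).
by rewrite smash_coact_mul smash_assoc.
Qed.

Definition smash_gamma (z : W2) : DW :=
  \sw_(w', w <- z) \sw_(v, r <- w') smash_gamma_base v (w ** coact r).

Lemma smash_gamma_lin : linear smash_gamma.
Proof. exact: tlift_lin (@lin_id _ _) smash_gamma_bal. Qed.

Lemma smash_gamma_tens v r w :
  smash_gamma ((v *t r) *t w) = smash_gamma_base v (w ** coact r).
Proof.
rewrite /smash_gamma (tlift_tens _ _ smash_gamma_bal).
exact: (tlift_tens _ _ (smash_gamma_bal_in w)).
Qed.

Lemma smash_gamma_cod q x : smash_gamma (smash_cod q x) = smash_dom q (gamma x).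
Proof.
move: x; apply tensor_ext.
- exact: lin_comp smash_gamma_lin (smash_cod_lin q).
- exact: lin_comp (smash_dom_lin q) gamma_lin.
move=> v u; rewrite smash_cod_tens smash_gamma_tens (ym_coact_one hR).
by rewrite smash_mulr1 smash_gamma_base_tens.
Qed.

Lemma smash_beta_gamma_base v w :
  betaW (smash_gamma_base v w) = (v *t 1R) *t w.
Proof.
move: w; apply tensor_ext.
- exact: lin_comp (beta_lin hW) (smash_gamma_base_lin_r v).
- by lin.
move=> u q; rewrite smash_gamma_base_tens smash_beta_dom betaK.
exact: smash_cod_tens.
Qed.

Lemma smash_betaK : cancel smash_gamma betaW.
Proof.
have hl := lin_comp (beta_lin hW) smash_gamma_lin.
apply tensor_ext; [exact: hl | by lin | move=> w' w].
move: w'; apply tensor_ext; [by apply: (lin_comp hl); lin | by lin | move=> v r].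
rewrite smash_gamma_tens smash_beta_gamma_base.
exact: esym (smash_tens_mid1 v r w).
Qed.

Lemma smash_gammaK : cancel betaW smash_gamma.
Proof.
have hl := lin_comp smash_gamma_lin (beta_lin hW).
apply tensor_ext; [exact: hl | by lin | move=> w' w].
move: w'; apply tensor_ext; [by apply: (lin_comp hl); lin | by lin | move=> v r].
(* In the domain r crosses as a source on the left of w, leaving v # 1 in the first leg. *)
have -> : (v *t r) *t w = (v *t 1R) *t ((1a *t r : W) ** w) :> DW.
  by rewrite -smash_dom_mid smash_src_r (rmul1 hR).
(* The second leg is now an arbitrary element and can again be taken to be pure. *)
move: ((1a *t r : W) ** w); apply tensor_ext.
- by apply: (lin_comp hl); lin.
- by lin.
move=> c q; rewrite -smash_dom_tens smash_beta_dom smash_gamma_cod.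
by rewrite gammaK.
Qed.

End Inverse.

Lemma smash_beta_bijective :
  bijective (@beta_l k B V) -> bijective (@beta_l k (ym_alg R) (smash R)).
Proof.
case=> gamma gammaK betaK; exists (smash_gamma gamma).
  exact: smash_gammaK.
exact: smash_betaK.
Qed.

End Smash.

Theorem proposition2p6 (k : comPzRingType) (B : preAlgebra k)
    (V : preBialgebroid B) (R : preYDMonoid V)
    (hV : is_right_bialgebroid V)
    (hR : is_YD_monoid R)
    (hbc : is_braided_commutative R) :
  is_right_bialgebroid (smash R) /\
  (is_left_Hopf_algebroid V -> is_left_Hopf_algebroid (smash R)).
Proof.
have hW := smash_is_right_bialgebroid hV hR hbc.
split=> // -[_ bij]; split=> //.
exact: smash_beta_bijective hV hR hbc bij.
Qed.
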